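(* $(\mathfrak D,\sqcup\!\sqcup,u,\Delta,\epsilon)$ is a connected graded Hopf algebra of finite type over $\mathbb F_q$.
   Context: Let $q$ be a power of a prime and $\mathbb F_q$ the field with $q$ elements. Let $\Gamma=\{x_{n,\varepsilon}\}_{n\in\mathbb N,\varepsilon\in\mathbb F_q^*}$ be an alphabet with weights $w(x_{n,\varepsilon})=n$; $\langle\Gamma\rangle$ is the set of words (finite strings of letters, empty word $1$), juxtaposition is concatenation, the depth of a word is its number of letters and its weight the sum of the weights of its letters. Let $\mathfrak D$ be the $\mathbb F_q$-vector space with basis $\langle\Gamma\rangle$, graded by weight; write $x_n:=x_{n,1}$. For positive integers $r,s,j$ put $\Delta^j_{r,s}=(-1)^{r-1}\binom{j-1}{r-1}+(-1)^{s-1}\binom{j-1}{s-1}$ if $(q-1)\mid j$ and $0$ otherwise. The bilinear products $\diamond,\sqcup\!\sqcup$ on $\mathfrak D$ are defined recursively by $1\diamond\mathfrak a=\mathfrak a\diamond1=\mathfrak a$, $1\sqcup\!\sqcup\mathfrak a=\mathfrak a\sqcup\!\sqcup1=\mathfrak a$ and, for nonempty words $\mathfrak a=x_{a,\alpha}\mathfrak a_-$, $\mathfrak b=x_{b,\beta}\mathfrak b_-$: $\mathfrak a\diamond\mathfrak b=x_{a+b,\alpha\beta}(\mathfrak a_-\sqcup\!\sqcup\mathfrak b_-)+\sum_{i+j=a+b}\Delta^j_{a,b}x_{i,\alpha\beta}(x_j\sqcup\!\sqcup(\mathfrak a_-\sqcup\!\sqcup\mathfrak b_-))$ and $\mathfrak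 a\sqcup\!\sqcup\mathfrak b=x_{a,\alpha}(\mathfrak a_-\sqcup\!\sqcup\mathfrak b)+x_{b,\beta}(\mathfrak a\sqcup\!\sqcup\mathfrak b_-)+\mathfrak a\diamond\mathfrak b$ ($i,j$ positive integers). For a word $\mathfrak a=x_{i_1}\cdots x_{i_m}$ with all characters $1$ put $[\mathfrak a]=(-1)^m\Delta^{i_1}_{1,w(\mathfrak a)+1}\cdots\Delta^{i_m}_{1,w(\mathfrak a)+1}x_{i_1}\sqcup\!\sqcup\cdots\sqcup\!\sqcup x_{i_m}$, $[1]=1$. The coproduct $\Delta:\mathfrak D\to\mathfrak D\otimes\mathfrak D$ is linear with $\Delta(1)=1\otimes1$, $\Delta(x_{n,\varepsilon})=1\otimes x_{n,\varepsilon}+\sum_{r\ge1,\ r+w(\mathfrak a)=n}\binom{r+\mathrm{depth}(\mathfrak a)-2}{\mathrm{depth}(\mathfrak a)}x_{r,\varepsilon}\otimes[\mathfrak a]$ (sum over words $\mathfrak a$ with all characters $1$, $\binom{a}{b}=a(a-1)\cdots(a-b+1)/b!$), and for $\mathfrak u=x_{u,\varepsilon}\mathfrak v$ of depth $\ge2$, writing $\Delta(x_{u,\varepsilon})=1\otimes x_{u,\varepsilon}+\sum a\otimes b$ ($a$ letters) and $\Delta(\mathfrak v)=\sum a_{\mathfrak v}\otimes b_{\mathfrak v}$, $\Delta(\mathfrak u)=1\otimes\mathfrak u+\sum(a\,a_{\mathfrak v})\otimes(b\sqcup\!\sqcup b_{\mathfrak v})$. The unit $u:\mathbb F_q\to\mathfrak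 D$ sends $1$ to the empty word, and the counit $\epsilon:\mathfrak D\to\mathbb F_q$ is $\epsilon(1)=1$, $\epsilon(\mathfrak w)=0$ for nonempty words $\mathfrak w$. *)

(* Defs.v *)
From HB Require Import structures.
From mathcomp Require Import all_boot all_algebra.
From mathcomp Require Import finmap.
From mathcomp.multinomials Require Import monalg.

Set Implicit Arguments.
Unset Strict Implicit.
Unset Printing Implicit Defensive.

Import GRing.Theory.
Local Open Scope ring_scope.

(* {malg F[K]} is the F-vector space with basis K (finitely supported  *)
(* functions K -> F); << k >> is the basis vector of k.                *)

Definition lext (F : ringType) (K : choiceType) (V : lmodType F)
  (f : K -> V) (g : {malg F[K]}) : V :=
  \sum_(k <- msupp g) g@_k *: f k.

Definition bilext (F : ringType) (K1 K2 : choiceType) (V : lmodType F)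
  (f : K1 -> K2 -> V) (x : {malg F[K1]}) (y : {malg F[K2]}) : V :=
  lext (fun a => lext (fun b => f a b) y) x.

(* tensor product of two vectors: {malg F[K1 * K2]} = {malg F[K1]} (x) {malg F[K2]} *)
Definition tens (F : ringType) (K1 K2 : choiceType)
  (x : {malg F[K1]}) (y : {malg F[K2]}) : {malg F[(K1 * K2)%type]} :=
  bilext (fun a b => << (a, b) >>) x y.

(* D := {malg F[K]}, D (x) D := {malg F[K*K]},                         *)
(* D (x) D (x) D := {malg F[K*K*K]}.  The grading is given by a weight *)
(* function on the basis: D_n is spanned by the basis elements of      *)
(* weight n.                                                           *)
Section Hopf.
Variables (F : fieldType) (K : choiceType).
Local Notation D := {malg F[K]}.
Local Notation D2 := {malg F[(K * K)%type]}.
Local Notation D3 := {malg F[(K * K * K)%type]}.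

Variables (wt : K -> nat) (mul : D -> D -> D) (one : D)
          (cop : D -> D2) (eps : D -> F).

Definition unit_map (c : F) : D := c *: one.

Definition mul2 (X Y : D2) : D2 :=
  bilext (fun p p' => tens (mul << p.1 >> << p'.1 >>) (mul << p.2 >> << p'.2 >>)) X Y.

Definition cop_id (X : D2) : D3 :=
  lext (fun p => lext (fun r => << (r.1, r.2, p.2) >>) (cop << p.1 >>)) X.
Definition id_cop (X : D2) : D3 :=
  lext (fun p => lext (fun r => << (p.1, r.1, r.2) >>) (cop << p.2 >>)) X.

Definition eps_id (X : D2) : D := lext (fun p => eps << p.1 >> *: << p.2 >>) X.
Definition id_eps (X : D2) : D := lext (fun p => eps << p.2 >> *: << p.1 >>) X.

Definition mul_S_id (S : D -> D) (X : D2) : D := lext (fun p => mul (S << p.1 >>) << p.2 >>) X.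
Definition mul_id_S (S : D -> D) (X : D2) : D := lext (fun p => mul << p.1 >> (S << p.2 >>)) X.

Definition homog (n : nat) (x : D) : Prop := forall k, k \in msupp x -> wt k = n.

Record is_conn_graded_Hopf_finite_type : Prop := {
  mul_linl : forall (c : F) (x y z : D), mul (c *: x + y) z = c *: mul x z + mul y z;
  mul_linr : forall (c : F) (x y z : D), mul z (c *: x + y) = c *: mul z x + mul z y;
  cop_lin  : forall (c : F) (x y : D), cop (c *: x + y) = c *: cop x + cop y;
  eps_lin  : forall (c : F) (x y : D), eps (c *: x + y) = c * eps x + eps y;
  mulA  : forall x y z : D, mul (mul x y) z = mul x (mul y z);
  mul1x : forall x : D, mul one x = x;
  mulx1 : forall x : D, mul x one = x;
  coassoc  : forall x : D, cop_id (cop x) = id_cop (cop x);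
  counit_l : forall x : D, eps_id (cop x) = x;
  counit_r : forall x : D, id_eps (cop x) = x;
  cop_mul : forall x y : D, cop (mul x y) = mul2 (cop x) (cop y);
  cop_one : cop one = tens one one;
  eps_mul : forall x y : D, eps (mul x y) = eps x * eps y;
  eps_one : eps one = 1;
  antipode : exists S : D -> D,
    (forall (c : F) (x y : D), S (c *: x + y) = c *: S x + S y) /\
    (forall x : D, mul_S_id S (cop x) = unit_map (eps x) /\
                   mul_id_S S (cop x) = unit_map (eps x));
  grade_one : homog 0 one;
  grade_mul : forall a b : K, homog (wt a + wt b) (mul << a >> << b >>);
  grade_cop : forall a : K, forall p, p \in msupp (cop << a >>) -> (wt p.1 + wt p.2 = wt a)%N;
  grade_eps : forall a : K, (0 < wt a)%N -> eps << a >> = 0;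
  connected : forall x : D, homog 0 x -> exists c : F, x = c *: one;
  finite_type : forall n : nat, exists s : seq K, forall k : K, wt k = n -> k \in s
}.

End Hopf.

Section DAlgebra.
Variable F : finFieldType.

Definition qF : nat := #|F|.

Definition letter := {x : nat * F | (0 < x.1)%N && (x.2 != 0)}.
Definition lw (x : letter) : nat := (val x).1.
Definition lc (x : letter) : F := (val x).2.

Lemma default_letter_proof : ((0 < (1%N, (1%R : F)).1)%N && ((1%N, (1%R : F)).2 != 0)).
Proof. by rewrite /= oner_neq0. Qed.
Definition default_letter : letter := exist _ (1%N, (1%R : F)) default_letter_proof.

(* x_{n,e}; only ever used with n >= 1 and e != 0 (otherwise a dummy) *)
Definition L (n : nat) (e : F) : letter := insubd default_letter (n, e).

Definition word := seq letter.
Definition weight (w : word) : nat := sumn (map lw w).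
Definition depth (w : word) : nat := size w.

Definition DD := {malg F[word]}.
Definition DD2 := {malg F[(word * word)%type]}.

(* generalized binomial coefficient a(a-1)...(a-b+1)/b!, for a in Z *)
Definition binomz (a : int) (b : nat) : int :=
  match a with
  | Posz n => ('C(n, b))%:Z
  | Negz n => (-1) ^+ b * ('C(b + n, b))%:Z
  end.

Definition Dcoef (j r s : nat) : F :=
  if (qF.-1 %| j)%N then
    (-1) ^+ r.-1 * ('C(j.-1, r.-1))%:R + (-1) ^+ s.-1 * ('C(j.-1, s.-1))%:R
  else 0.

Definition lcons (x : letter) (v : DD) : DD := lext (fun w => << x :: w >>) v.

(* a ⋄ b for a = x a', b = y b', given the shuffle product sh on words
   (used below with the shuffle computed at smaller total depth) *)
Definition dm_with (sh : word -> word -> DD) (x : letter) (a' : word)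
    (y : letter) (b' : word) : DD :=
  let s := sh a' b' in
  lcons (L (lw x + lw y) (lc x * lc y)) s
  + \sum_(j <- iota 1 (lw x + lw y).-1)      (* i + j = a + b, i, j >= 1 *)
      Dcoef j (lw x) (lw y) *:
        lcons (L (lw x + lw y - j) (lc x * lc y))
              (lext (fun w => sh [:: L j 1] w) s).

(* shuffle on words, by recursion on a fuel bound n (any n > total depth
   gives the paper's recursive definition) *)
Fixpoint sh_fuel (n : nat) (a b : word) {struct n} : DD :=
  match n with
  | 0 => 0
  | n'.+1 =>
    match a, b with
    | [::], _ => << b >>
    | _, [::] => << a >>
    | x :: a', y :: b' =>
        lcons x (sh_fuel n' a' b) + lcons y (sh_fuel n' a b')
        + dm_with (sh_fuel n') x a' y b'
    end
  end.

Definition shw (a b : word) : DD := sh_fuel (size a + size b).+1 a b.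
Definition dmw (x : letter) (a' : word) (y : letter) (b' : word) : DD :=
  dm_with shw x a' y b'.

Definition shuffle (u v : DD) : DD := bilext shw u v.

Definition oneD : DD := << [::] >>.
Definition counit (u : DD) : F := u@_[::].

Fixpoint comps_fuel (k m : nat) : seq (seq nat) :=
  match k with
  | 0 => if m == 0%N then [:: [::]] else [::]
  | k'.+1 =>
    if m == 0%N then [:: [::]]
    else flatten [seq [seq i :: c | c <- comps_fuel k' (m - i)] | i <- iota 1 m]
  end.
Definition compositions (m : nat) : seq (seq nat) := comps_fuel m m.

Definition word1 (c : seq nat) : word := [seq L i 1 | i <- c].

(* [a] for a = x_{i_1} ... x_{i_m} (characters 1), given by c = (i_1,...,i_m):
   (-1)^m Delta^{i_1}_{1,w+1} ... Delta^{i_m}_{1,w+1}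
      x_{i_1} ⧢ (x_{i_2} ⧢ ( ... ⧢ x_{i_m})) *)
Definition brk (c : seq nat) : DD :=
  let w := sumn c in
  ((-1) ^+ size c * \prod_(i <- c) Dcoef i 1 (w + 1)) *:
    foldr (fun i acc => shuffle << [:: L i 1] >> acc) oneD c.

Definition tens_w (u : word) (v : DD) : DD2 := lext (fun w => << (u, w) >>) v.

(* Delta(x_{n,e}) - 1 (x) x_{n,e}
   = sum_{r >= 1, r + w(a) = n} binom(r + depth a - 2, depth a) x_{r,e} (x) [a] *)
Definition cop_letter_red (x : letter) : DD2 :=
  \sum_(r <- iota 1 (lw x))
    \sum_(c <- compositions (lw x - r))
      (binomz ((r + size c)%:Z - 2) (size c))%:~R *:
        tens_w [:: L r (lc x)] (brk c).

Fixpoint cop_word (w : word) : DD2 :=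
  match w with
  | [::] => << ([::], [::]) >>
  | x :: v =>
    match v with
    | [::] => << ([::], [:: x]) >> + cop_letter_red x
    | _ :: _ =>
      << ([::], w) >> +
      \sum_(r <- iota 1 (lw x))
        \sum_(c <- compositions (lw x - r))
          (binomz ((r + size c)%:Z - 2) (size c))%:~R *:
            lext (fun p => tens_w (L r (lc x) :: p.1) (shuffle (brk c) << p.2 >>))
                 (cop_word v)
    end
  end.

Definition coproduct (u : DD) : DD2 := lext cop_word u.

End DAlgebra.

(* Main.v *)
Require Import Defs.
From HB Require Import structures.
From mathcomp Require Import all_boot all_fingroup all_algebra all_solvable all_field.
From mathcomp Require Import finmap ring.
From mathcomp.multinomials Require Import monalg.

Set Implicit Arguments.
Unset Strict Implicit.
Unset Printing Implicit Defensive.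
Import GRing.Theory FinRing.Theory.
Local Open Scope ring_scope.

(* Words are evaluated in the field E = F(X) at flags: finite sequences of vectors t_d
   (listed top first) with t_d outside the F-span V_d of the lower ones, each carrying an
   exponent k_d.  A word x_{n_1,e_1} ... x_{n_r,e_r} takes the value
     sum_{d_1 > ... > d_r} prod_i e_i^(k_{d_i}) sum_{f in t_{d_i} + V_{d_i}} f^(-n_i);
   for t_d = theta^d and k_d = d these are the truncated alternating multiple zeta values.

   - Evaluation turns the shuffle product into multiplication: split the double sums
     of f^(-a) g^(-b) along h = f - g and use partial fractions.
   - Evaluation at a concatenated flag fl' ++ fl is the evaluation of the coproduct at
     (e(fl'), fl), where e(T) = T prod_{h in V \ 0} (1 - T/h) is the F-linear polynomial
     of the span V of fl.  This rests on sum_{v in V} 1/(z + v - T) = 1/(e(z) - e(T)) and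
     T/e(T) = 1 - sum_j N_j T^j with N_j = sum_{h in V \ 0} h^(-j); the brackets [a]
     evaluate to the products of the N_j.
   - Evaluations separate words, even with coefficients in E: power sums of order n are
     monic polynomials of degree n in 1/e(t), and the k_d separate the characters.

   Hence associativity, coassociativity, the counit laws and the compatibility of the
   coproduct with the product all follow from identities in E (for coassociativity, from
   e_{fl' ++ fl} = e_{e(fl')} o e).  The antipode exists in any connected graded
   bialgebra. *)

Lemma big_iota1 (V : nmodType) (n : nat) (f : nat -> V) :
  \sum_(j <- iota 1 n) f j = \sum_(j < n) f j.+1.
Proof.
by rewrite -(big_mkord xpredT (fun j => f j.+1)) -[1%N]/(1 + 0)%N iotaDl big_map /index_iota subn0.
Qed.

(** * Partial fractions for products of inverse powers *)

Section PartialFractions.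
Variable E : fieldType.
Implicit Types x y z h : E.

(** The terms [binom(j-1, a) z^(-i) h^(-j)] over positive [i + j = n + 1], where the exponent of [h]
    is written [j.+1]. The binomials are those of Δ^j_{r,s} with [r = a + 1]. *)
Definition pfrac z h a n : E := \sum_(j < n) 'C(j, a)%:R * (z ^- (n - j) * h ^- j.+1).

Lemma pfracS z h a n : pfrac z h a.+1 n.+1 = h^-1 * (pfrac z h a.+1 n + pfrac z h a n).
Proof.
rewrite /pfrac big_ord_recl /= bin0n mul0r add0r -big_split mulr_sumr /=.
apply: eq_bigr => j _; rewrite /bump /= add1n binS natrD subSS [in LHS]exprS invfM; ring.
Qed.

Lemma pfrac0 z h n : pfrac z h 0 n.+1 = h^-1 * (z ^- n.+1 + pfrac z h 0 n).
Proof.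
rewrite /pfrac big_ord_recl /= bin0 subn0 expr1 mul1r mulrDr mulrC; congr (_ + _).
rewrite mulr_sumr; apply: eq_bigr => j _.
rewrite /bump /= add1n !bin0 !mul1r subSS [in LHS]exprS invfM; ring.
Qed.

Lemma pfrac_small z h a n : (n <= a)%N -> pfrac z h a n = 0.
Proof.
move=> le_na; apply: big1 => j _; rewrite bin_small ?mul0r //.
exact: leq_trans (ltn_ord j) le_na.
Qed.

(* Induction on [a + b], multiplying by [1 = (x - y) / (x - y)]; both sides are invariant
   under [(x, a) <-> (y, b)]. *)
Lemma partial_fractions x y a b : x != 0 -> y != 0 -> x != y ->
  x ^- a.+1 * y ^- b.+1 =
  - ((-1) ^+ a * pfrac y (y - x) a (a + b).+1 + (-1) ^+ b * pfrac x (x - y) b (a + b).+1).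
Proof.
have [n] := ubnP (a + b).
elim: n a b x y => // n IHn a b x y lt_ab x0 y0 xy.
wlog le_ab : a b x y lt_ab x0 y0 xy / (a <= b)%N => [wl|].
  have [/wl|/ltnW/wl wl'] := leqP a b; first exact.
  by rewrite mulrC addnC addrC wl' // 1?addnC // eq_sym.
have h0 : x - y != 0 by rewrite subr_eq0.
have hE : y - x = - (x - y) by rewrite opprB.
have stepE c d : x ^- c.+1 * y ^- d.+1 = (x - y)^-1 * (x ^- c * y ^- d.+1 - x ^- c.+1 * y ^- d).
  rewrite !exprS !invfM; field.
  by rewrite h0 y0 x0 !expf_neq0.
case: b le_ab lt_ab => [|b].
  rewrite leqn0 => /eqP -> _; rewrite stepE !pfrac0 !pfrac_small // hE invrN.
  rewrite !expr0 !expr1 !invr1; ring.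
case: a => [|a] _ lt_ab.
  rewrite stepE IHn // !add0n (pfrac0 _ _ b.+1) pfracS (@pfrac_small _ _ b.+1) // hE invrN.
  by rewrite (exprS (-1)) !expr0 invr1; ring.
have lt1 : (a + b.+1 < n)%N by rewrite addSn in lt_ab.
have lt2 : (a.+1 + b < n)%N by rewrite addSnnS.
rewrite stepE !IHn // addSnnS addSn addnS.
rewrite !pfracS hE invrN !(exprS (-1)); ring.
Qed.

End PartialFractions.

(** * Flags and their additive polynomials *)

Section Flags.
Variables (F : finFieldType) (E : fieldType) (iota : {rmorphism F -> E}).
Local Notation q := #|F|.
Implicit Types (fl : seq (E * nat)) (z : E).

Lemma iota_card c : iota c ^+ q = iota c.
Proof. by rewrite -rmorphXn expf_card. Qed.

(** [q] is a power of the characteristic p, because the additive group of [F] is an elementary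
    abelian p-group. *)
Lemma frobeniusD (x y : E) : (x + y) ^+ q = x ^+ q + y ^+ q.
Proof.
apply: exprDn_pchar; have [p p_pr pF] := finPcharP F.
have pE : p \in [pchar E] by rewrite (fmorph_pchar iota).
rewrite (eq_pnat _ (pcharf_eq pE)) -cardsT.
by have /and3P[] := fin_ring_pchar_abelem pF.
Qed.

Lemma card_gt1 : (1 < q)%N.
Proof. exact: finNzRing_gt1. Qed.

Lemma exprqS (x : E) : x ^+ q = x * x ^+ q.-1.
Proof. by rewrite -exprS prednK // (ltnW card_gt1). Qed.

Lemma expr0q : 0 ^+ q = 0 :> E.
Proof. by rewrite exprqS mul0r. Qed.

Lemma natr_card0 : q%:R = 0 :> E.
Proof.
have [p p_pr pF] := finPcharP F.
have pE : p \in [pchar E] by rewrite (fmorph_pchar iota).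
apply/eqP; rewrite -(dvdn_pcharf pE).
have /and3P[pq _ _] := fin_ring_pchar_abelem pF.
move: pq; rewrite /pgroup cardsT => /p_natP[[|k] qE]; last by rewrite qE expnS dvdn_mulr.
by have := card_gt1; rewrite qE.
Qed.

Lemma deriv_prod_XsubC (s : seq E) z : z \notin s ->
  (\prod_(a <- s) ('X - a%:P))^`().[z] =
  (\prod_(a <- s) (z - a)) * \sum_(a <- s) (z - a)^-1.
Proof.
elim: s => [|a s IHs]; first by rewrite !big_nil derivC horner0 mulr0.
rewrite inE negb_or => /andP[za zs].
rewrite !big_cons derivM hornerD !hornerM IHs // derivXsubC hornerXsubC hornerC.
rewrite horner_prod; under eq_bigr do rewrite hornerXsubC.
by field; rewrite subr_eq0.
Qed.

Lemma prod_sub_iota z : \prod_c (z - iota c) = z ^+ q - z.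
Proof.
transitivity (map_poly iota (\prod_(c : F) ('X - c%:P))).[z].
  rewrite rmorph_prod horner_prod; apply: eq_bigr => c _ /=.
  by rewrite rmorphB /= map_polyX map_polyC hornerXsubC.
by rewrite -finField_genPoly rmorphB /= map_polyXn map_polyX hornerD hornerN hornerXn hornerX.
Qed.

(** Logarithmic derivative of [X^q - X], whose roots are the elements of [F] and whose derivative is
    the constant -1. *)
Lemma sum_inv_shift z : z ^+ q != z -> \sum_c (z + iota c)^-1 = (z - z ^+ q)^-1.
Proof.
move=> zq; set s := map iota (index_enum F).
have zs : z \notin s by apply: contraNN zq => /mapP[c _ ->]; rewrite iota_card.
have := deriv_prod_XsubC zs; rewrite !big_map.
have -> : \prod_c ('X - (iota c)%:P) = 'X^q - 'X.
  transitivity (map_poly iota (\prod_(c : F) ('X - c%:P))).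
    by rewrite rmorph_prod; apply: eq_bigr => c _ /=; rewrite rmorphB /= map_polyX map_polyC.
  by rewrite -finField_genPoly rmorphB /= map_polyXn map_polyX.
rewrite derivB derivXn derivX hornerD hornerN hornerMn hornerC -mulr_natr natr_card0 mulr0 add0r.
rewrite prod_sub_iota => eq1.
rewrite (reindex_inj oppr_inj) /=; under eq_bigr do rewrite rmorphN.
have nz : z ^+ q - z != 0 by rewrite subr_eq0.
by apply: (mulfI nz); rewrite -eq1 -[z - z ^+ q]opprB invrN mulrN mulfV.
Qed.

(* The [F]-linear polynomial vanishing exactly on [fspan fl], normalised to have
   linear coefficient 1. *)
Fixpoint fexp fl z : E :=
  if fl is x :: fl' then fexp fl' z - fexp fl' z ^+ q / fexp fl' x.1 ^+ q.-1 else z.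

Fixpoint fspan fl : seq E :=
  if fl is x :: fl' then [seq iota c * x.1 + v | c <- index_enum F, v <- fspan fl'] else [:: 0].

(** Since [fexp fl'] vanishes exactly on the span of [fl'], this is linear independence over [F],
    expressed by inequations in [E]. *)
Fixpoint fvalid fl : bool :=
  if fl is x :: fl' then (fexp fl' x.1 != 0) && fvalid fl' else true.

Definition fsig fl n z : E := \sum_(v <- fspan fl) (z + v) ^- n.

Lemma fexpD fl : {morph fexp fl : x y / x + y}.
Proof.
elim: fl => [|s fl IH] x y //=.
by rewrite IH frobeniusD; ring.
Qed.

Lemma fexpZ fl c x : fexp fl (iota c * x) = iota c * fexp fl x.
Proof. by elim: fl => [|s fl IH] //=; rewrite IH exprMn iota_card; ring. Qed.

Lemma fexp0 fl : fexp fl 0 = 0.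
Proof. by rewrite -[X in fexp fl X](mul0r 0) -(rmorph0 iota) fexpZ rmorph0 mul0r. Qed.

Lemma fexp_head s fl : fexp (s :: fl) s.1 = 0.
Proof.
rewrite /=; set y := fexp fl s.1; have [->|y0] := eqVneq y 0.
  by rewrite expr0q mul0r subr0.
by rewrite exprqS mulfK ?subrr ?expf_neq0.
Qed.

Lemma fexp_cons0 fl z s : fexp fl z = 0 -> fexp (s :: fl) z = 0.
Proof. by move=> /= ->; rewrite expr0q mul0r subr0. Qed.

Lemma fexp_span fl v : v \in fspan fl -> fexp fl v = 0.
Proof.
elim: fl v => [|s fl IH] v; first by rewrite inE => /eqP.
move=> /allpairsP[[c w] /= [_ /IH w0 ->]].
rewrite -/(fexp (s :: fl) _) fexpD fexpZ fexp_head mulr0 add0r.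
exact: fexp_cons0.
Qed.

Lemma fexp_neq0 fl z v : v \in fspan fl -> fexp fl z != 0 -> z + v != 0.
Proof. by move=> /fexp_span v0; apply: contra_neq => zv; rewrite -(fexp0 fl) -zv fexpD v0 addr0. Qed.

Lemma big_fspan_cons s fl (phi : E -> E) :
  \sum_(v <- fspan (s :: fl)) phi v = \sum_c \sum_(v <- fspan fl) phi (iota c * s.1 + v).
Proof. by rewrite /= big_allpairs_dep. Qed.

(** Induction on the flag. With [x = fexp fl z] and [y = fexp fl s.1], the new sum is that of
    [1 / (x + c y)] over [c] in [F]; [sum_inv_shift] at [x / y] evaluates it as the inverse of
    [x - x^q / y^(q-1)]. *)
Lemma fsig1 fl z : fvalid fl -> fexp fl z != 0 -> fsig fl 1 z = (fexp fl z)^-1.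
Proof.
elim: fl z => [|s fl IH] z; first by rewrite /fsig big_seq1 addr0 expr1.
move=> /andP[s0 fl_ok] z0; rewrite /fsig big_fspan_cons.
set x := fexp fl z; set y := fexp fl s.1.
have zc c : fexp fl (z + iota c * s.1) != 0.
  apply: contra_neq z0 => zc0.
  have /(_ s) := fexp_cons0 _ zc0.
  by rewrite fexpD fexpZ fexp_head mulr0 addr0.
under eq_bigr => c _.
  under eq_bigr do rewrite addrA.
  rewrite -/(fsig fl 1 _) IH // fexpD fexpZ -/x -/y.
  have -> : x + iota c * y = y * (x / y + iota c) by field.
  rewrite invfM; over.
have eqe : fexp (s :: fl) z = y * (x / y - (x / y) ^+ q).
  rewrite /= -/x -/y exprMn exprVn [y ^+ q]exprqS; field.
  by rewrite s0 expf_neq0.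
rewrite -mulr_sumr sum_inv_shift ?eqe ?invfM //.
by apply: contra_neq z0 => xyq; rewrite eqe xyq subrr mulr0.
Qed.

Lemma big_fspan_shift fl u (phi : E -> E) : u \in fspan fl ->
  \sum_(v <- fspan fl) phi (u + v) = \sum_(v <- fspan fl) phi v.
Proof.
elim: fl u phi => [|s fl IH] u phi; first by rewrite inE => /eqP ->; rewrite !big_seq1 addr0.
move=> /allpairsP[[c w] /= [_ w_in ->]].
rewrite !(big_fspan_cons s) [RHS](reindex_inj (addrI c)) /=; apply: eq_bigr => d _.
rewrite -[RHS](IH w) //; apply: eq_bigr => v _; congr phi.
by rewrite rmorphD; ring.
Qed.

Lemma big_fspan_scale fl c (phi : E -> E) : c != 0 ->
  \sum_(v <- fspan fl) phi (iota c * v) = \sum_(v <- fspan fl) phi v.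
Proof.
move=> c0; elim: fl phi => [|s fl IH] phi; first by rewrite !big_seq1 mulr0.
rewrite !(big_fspan_cons s) [RHS](reindex_inj (mulfI c0)) /=; apply: eq_bigr => d _.
rewrite -[RHS]IH; apply: eq_bigr => v _; congr phi.
by rewrite rmorphM; ring.
Qed.

(* One representative of each line of [fspan fl]; for the flag [theta^0, theta^1, ...]
   these are the monic polynomials. *)
Fixpoint fmonic fl : seq E :=
  if fl is x :: fl' then [seq x.1 + v | v <- fspan fl'] ++ fmonic fl' else [::].

Lemma fmonic_span fl v : v \in fmonic fl -> v \in fspan fl.
Proof.
elim: fl v => [|s fl IH] v //=; rewrite mem_cat => /orP[/mapP[w w_in ->]|/IH v_in].
  by apply/allpairsP; exists (1, w); rewrite /= rmorph1 mul1r mem_index_enum.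
by apply/allpairsP; exists (0, v); rewrite /= rmorph0 mul0r add0r mem_index_enum.
Qed.

Lemma fmonic_neq0 fl v : fvalid fl -> v \in fmonic fl -> v != 0.
Proof.
elim: fl v => [|s fl IH] v //= /andP[s0 fl_ok].
rewrite mem_cat => /orP[/mapP[w w_in ->]|]; last exact: IH.
exact: fexp_neq0 w_in s0.
Qed.

(** If [q - 1] divides [j], there are [q - 1 = -1] terms equal to 1. Otherwise substituting
    [c -> a c], with [a] a generator of the cyclic group of units, multiplies the sum by [a^(-j)],
    which is not 1. This is the source of the divisibility condition in Δ^j. *)
Lemma sum_units_expr j : \sum_(c : F | c != 0) (iota c) ^- j = if (q.-1 %| j)%N then -1 else 0.
Proof.
have [dvd|ndvd] := ifPn.
  under eq_bigr => c c0.
    have -> : iota c ^- j = 1.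
      have c1 : iota c ^+ q.-1 = 1.
        apply: (@mulfI _ (iota c)); first by rewrite fmorph_eq0.
        by rewrite -exprqS iota_card mulr1.
      by rewrite -(divnK dvd) mulnC exprM c1 expr1n invr1.
    over.
  rewrite sumr_const (eq_card (B := predC1 0)) // cardC1.
  apply: (addIr 1); rewrite addNr -mulrSr prednK ?(ltnW card_gt1) //.
  exact: natr_card0.
have [g g_gen] : exists g : {unit F}, [set: {unit F}] = <[g]>%g.
  exact/cyclicP/field_unit_group_cyclic.
pose a := val g; have a0 : a != 0 by rewrite -unitfE; exact: valP g.
have aj : a ^+ j != 1.
  apply: contraNN ndvd => /eqP aj1.
  rewrite -card_finField_unit g_gen -orderE order_dvdn -val_eqE /= val_unitX -/a.
  by rewrite aj1.
set S := \sum_(c | _) _.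
have : S = iota a ^- j * S.
  rewrite [LHS](reindex_inj (mulfI a0)) /= mulr_sumr.
  apply: eq_big => [c|c _]; first by rewrite mulf_eq0 (negPf a0).
  by rewrite rmorphM exprMn invfM.
move=> /eqP; rewrite -subr_eq0 -{1}[S]mul1r -mulrBl mulf_eq0 subr_eq0 => /orP[|/eqP->//].
by rewrite eq_sym invr_eq1 -rmorphXn fmorph_eq1 (negPf aj).
Qed.

Definition fnz fl : seq E :=
  [seq iota c * m | c <- [seq c <- index_enum F | c != 0], m <- fmonic fl].

Lemma big_fnz fl (phi : E -> E) :
  \sum_(h <- fnz fl) phi h = \sum_(c | c != 0) \sum_(m <- fmonic fl) phi (iota c * m).
Proof. by rewrite big_allpairs_dep big_filter. Qed.

Lemma big_fspan_nz fl (phi : E -> E) :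
  \sum_(v <- fspan fl) phi v = phi 0 + \sum_(h <- fnz fl) phi h.
Proof.
rewrite big_fnz; elim: fl phi => [|s fl IH] phi.
  by rewrite big_seq1 big1 ?addr0 // => c _; rewrite big_nil.
rewrite (big_fspan_cons s) (bigD1 0) //=.
under eq_bigr do rewrite rmorph0 mul0r add0r.
rewrite IH -addrA -big_split /=; congr (_ + _); apply: eq_bigr => c c0.
rewrite big_cat big_map /= addrC; congr (_ + _).
rewrite -(big_fspan_scale _ _ c0); apply: eq_bigr => v _.
by rewrite mulrDr.
Qed.

Lemma fnz_expr fl j : \sum_(h <- fnz fl) h ^- j =
  if (q.-1 %| j)%N then - \sum_(m <- fmonic fl) m ^- j else 0.
Proof.
rewrite big_fnz; under eq_bigr => c _.
  under eq_bigr do rewrite exprMn invfM.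
  rewrite -mulr_sumr; over.
by rewrite -mulr_suml sum_units_expr; case: ifP; rewrite ?mulN1r ?mul0r.
Qed.

Lemma big_fnzN fl (phi : E -> E) : \sum_(h <- fnz fl) phi (- h) = \sum_(h <- fnz fl) phi h.
Proof.
rewrite !big_fnz [RHS](reindex_inj oppr_inj) /=; apply: eq_big => [c|c _].
  by rewrite oppr_eq0.
by apply: eq_bigr => m _; rewrite rmorphN mulNr.
Qed.

Lemma fspan_scale fl c v : v \in fspan fl -> iota c * v \in fspan fl.
Proof.
elim: fl v => [|s fl IH] v; first by rewrite !inE => /eqP->; rewrite mulr0.
move=> /allpairsP[[d w] /= [_ w_in ->]]; apply/allpairsP; exists (c * d, iota c * w).
by rewrite /= mem_index_enum IH // rmorphM; split=> //; ring.
Qed.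

Lemma fspanN fl v : v \in fspan fl -> - v \in fspan fl.
Proof. by move=> /(fspan_scale (-1)); rewrite rmorphN1 mulN1r. Qed.

Lemma fnz_span fl h : h \in fnz fl -> h \in fspan fl.
Proof. by move=> /allpairsP[[c m] /= [_ /fmonic_span m_in ->]]; exact: fspan_scale. Qed.

Lemma fnz_neq0 fl h : fvalid fl -> h \in fnz fl -> h != 0.
Proof.
move=> fl_ok /allpairsP[[c m] /= [c0 /(fmonic_neq0 fl_ok) m0 ->]].
by rewrite mulf_neq0 ?fmorph_eq0 //; move: c0; rewrite mem_filter => /andP[].
Qed.

Definition nzsum fl j : E := \sum_(h <- fnz fl) h ^- j.

(** Translation by [h] permutes the span, so the sum over [v] does not see the shift and the double
    sum factors. In [sum_pfrac2] the sign of [h] is absorbed by the symmetry of [fnz]. *)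
Lemma sum_pfrac1 fl z a n :
  \sum_(v <- fspan fl) \sum_(h <- fnz fl) pfrac (z + v + h) h a n =
  \sum_(j < n) 'C(j, a)%:R * (fsig fl (n - j) z * nzsum fl j.+1).
Proof.
rewrite exchange_big /= /pfrac.
under eq_bigr do rewrite exchange_big /=.
rewrite exchange_big /=; apply: eq_bigr => j _.
rewrite /nzsum !mulr_sumr big_seq [RHS]big_seq; apply: eq_bigr => h h_in.
rewrite -mulr_sumr -mulr_suml; congr (_ * (_ * _)).
rewrite /fsig -[RHS](big_fspan_shift _ (fnz_span h_in)).
by apply: eq_bigr => v _; congr ((_ ^+ _)^-1); ring.
Qed.

Lemma sum_pfrac2 fl z a n :
  \sum_(v <- fspan fl) \sum_(h <- fnz fl) pfrac (z + v) (- h) a n =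
  \sum_(j < n) 'C(j, a)%:R * (fsig fl (n - j) z * nzsum fl j.+1).
Proof.
under eq_bigr do rewrite (big_fnzN _ (fun h => pfrac _ h _ _)).
rewrite exchange_big /= /pfrac.
under eq_bigr do rewrite exchange_big /=.
rewrite exchange_big /=; apply: eq_bigr => j _.
rewrite /nzsum !mulr_sumr; apply: eq_bigr => h _.
by rewrite -mulr_sumr -mulr_suml.
Qed.

(** In the double sum over [v, w] the diagonal gives [fsig] of order [a + b + 2]. Off the diagonal,
    with difference [h], partial fractions give the two binomial sums. The restriction [(q-1) | j]
    of Δ^j is carried by [nzsum], which vanishes for the other [j]. *)
Lemma fsig_mul fl z a b : fvalid fl -> fexp fl z != 0 ->
  fsig fl a.+1 z * fsig fl b.+1 z = fsig fl (a + b).+2 z -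
  \sum_(j < (a + b).+1) ((-1) ^+ a * 'C(j, a)%:R + (-1) ^+ b * 'C(j, b)%:R) *
     (fsig fl ((a + b).+1 - j) z * nzsum fl j.+1).
Proof.
move=> fl_ok z0; rewrite [fsig fl a.+1 z]/fsig mulr_suml.
under [in RHS]eq_bigr do rewrite mulrDl -!mulrA.
rewrite big_split /= -!mulr_sumr -(sum_pfrac1 _ _ a) -(sum_pfrac2 _ _ b).
rewrite [fsig fl (a + b).+2 z]/fsig !mulr_sumr -big_split /= -sumrB big_seq [RHS]big_seq.
(* The second factor is recentred at [v], so that [w = 0] is the diagonal term. *)
apply: eq_bigr => v v_in; rewrite [fsig _ _ _](_ : _ = \sum_(w <- fspan fl) (z + v + w) ^- b.+1).
  rewrite (big_fspan_nz _ (fun w => (z + v + w) ^- b.+1)) addr0 mulrDr.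
  rewrite -invfM -exprD addSn addnS; congr (_ + _).
  rewrite !mulr_sumr -big_split /= -sumrN big_seq [RHS]big_seq; apply: eq_bigr => h h_in.
  have zv : z + v != 0 := fexp_neq0 v_in z0.
  rewrite partial_fractions //.
  - by congr (- (_ * pfrac _ _ _ _ + _ * pfrac _ _ _ _)); ring.
  - apply: (fexp_neq0 (fnz_span h_in)).
        by rewrite fexpD (fexp_span v_in) addr0.
  - by rewrite -subr_eq0 opprD addNKr oppr_eq0 (fnz_neq0 fl_ok h_in).
by rewrite /fsig -[LHS](big_fspan_shift _ v_in); apply: eq_bigr => w _; rewrite addrA.
Qed.

Lemma geometric_invr (x h : E) n : x != 0 -> h != 0 -> x - h != 0 ->
  \sum_(i < n) h ^- i.+1 * x ^- (n - i) = (h ^- n - x ^- n) / (x - h).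
Proof.
move=> x0 h0 xh; elim: n => [|n IHn]; first by rewrite big_ord0 subrr mul0r.
rewrite big_ord_recr /= subSnn.
under eq_bigr => i _ do rewrite subSn ?(ltnW (ltn_ord i)) // [x ^+ _.+1]exprS invfM mulrCA.
rewrite -mulr_sumr IHn !exprS; field.
by rewrite xh !expf_neq0 //= x0 h0.
Qed.

(** The double sum of [(h^(-n-1) - (z+v)^(-n-1)) / (z + v - h)] is computed twice: as a finite
    geometric sum, and by splitting the numerator. In the second computation, the sum of
    [1 / (z + v - h)] over [v] is [fsig 1], and over nonzero [h] it is [fsig 1] minus the missing
    term [1 / (z + v)]. *)
Lemma fsig_rec fl z n : fvalid fl -> fexp fl z != 0 ->
  fsig fl n.+2 z = fsig fl 1 z * (fsig fl n.+1 z - nzsum fl n.+1)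
    + \sum_(i < n.+1) nzsum fl i.+1 * fsig fl (n.+1 - i) z.
Proof.
move=> fl_ok z0.
have -> : \sum_(i < n.+1) nzsum fl i.+1 * fsig fl (n.+1 - i) z =
  \sum_(v <- fspan fl) \sum_(h <- fnz fl) (h ^- n.+1 - (z + v) ^- n.+1) / (z + v - h).
  under eq_bigr => i _ do rewrite /nzsum /fsig mulr_suml.
  rewrite exchange_big /= [RHS]exchange_big /= big_seq [RHS]big_seq.
  apply: eq_bigr => h h_in.
  under eq_bigr do rewrite mulr_sumr.
  rewrite exchange_big /= big_seq [RHS]big_seq; apply: eq_bigr => v v_in.
  rewrite geometric_invr ?(fexp_neq0 v_in z0) ?(fnz_neq0 fl_ok h_in) //.
  apply: (@fexp_neq0 fl); first exact/fspanN/fnz_span.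
  by rewrite fexpD (fexp_span v_in) addr0.
under eq_bigr do (under eq_bigr do rewrite mulrBl); under eq_bigr do rewrite sumrB.
rewrite sumrB exchange_big /=.
have -> : \sum_(h <- fnz fl) \sum_(v <- fspan fl) h ^- n.+1 / (z + v - h) = fsig fl 1 z * nzsum fl n.+1.
  rewrite mulr_sumr big_seq [RHS]big_seq; apply: eq_bigr => h h_in.
  rewrite -mulr_sumr mulrC; congr (_ * _).
  rewrite /fsig -[RHS](big_fspan_shift _ (fspanN (fnz_span h_in))).
  by apply: eq_bigr => v _; rewrite expr1; congr (_^-1); ring.
have -> : \sum_(v <- fspan fl) \sum_(h <- fnz fl) (z + v) ^- n.+1 / (z + v - h) =
  fsig fl 1 z * fsig fl n.+1 z - fsig fl n.+2 z.
  rewrite [fsig fl n.+1 z]/fsig [fsig fl n.+2 z]/fsig mulr_sumr -sumrB big_seq [RHS]big_seq.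
  apply: eq_bigr => v v_in; rewrite -mulr_sumr (big_fnzN _ (fun h => (z + v + h)^-1)).
  have := big_fspan_nz fl (fun h => (z + v + h)^-1).
  rewrite addr0 => /(canLR (addKr _)) <-.
  have -> : \sum_(w <- fspan fl) (z + v + w)^-1 = fsig fl 1 z.
    rewrite /fsig -[RHS](big_fspan_shift _ v_in).
    by apply: eq_bigr => w _; rewrite addrA expr1.
  by rewrite [_ ^+ n.+2]exprS invfM; ring.
ring.
Qed.

End Flags.

(** * Compositions and the coefficients [gamma] *)

Lemma comps_fuelS k m : comps_fuel k.+1 m.+1 =
  flatten [seq [seq i :: c | c <- comps_fuel k (m.+1 - i)] | i <- iota 1 m.+1].
Proof. by []. Qed.

Lemma leq_subS n j : (0 < j)%N -> (n.+1 - j <= n)%N.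
Proof. by move=> j0; rewrite leq_subLR -add1n leq_add2r. Qed.

Lemma comps_fuelE k m : (m <= k)%N -> comps_fuel k m = compositions m.
Proof.
rewrite /compositions; have [n] := ubnP k.
elim: n k m => // n IHn [|k] [|m] // le_kn le_mk.
rewrite !comps_fuelS; congr flatten; apply/eq_in_map => i; rewrite mem_iota add1n ltnS => /andP[i0 le_i].
have le_mi := leq_subS m i0.
have lt_mn : (m < n)%N by apply: leq_ltn_trans (_ : k < n)%N; rewrite -ltnS.
rewrite !(IHn _ (m.+1 - i)%N) //; exact: leq_trans le_mi _.
Qed.

Lemma big_compositions0 (V : nmodType) (f : seq nat -> V) :
  \sum_(c <- compositions 0) f c = f [::].
Proof. by rewrite big_seq1. Qed.

Lemma big_compositionsS (V : nmodType) (f : seq nat -> V) n :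
  \sum_(c <- compositions n.+1) f c =
  \sum_(i < n.+1) \sum_(c <- compositions (n - i)) f (i.+1 :: c).
Proof.
rewrite /compositions comps_fuelS.
rewrite big_flatten big_map (big_iota1 _ (fun i => \sum_(c <- _) f c)).
apply: eq_bigr => i _; rewrite big_map subSS comps_fuelE //; exact: leq_subr.
Qed.

Lemma compositions_gt0 n c i : c \in compositions n -> i \in c -> (0 < i)%N.
Proof.
elim/ltn_ind: n c => -[|n] IHn c; first by rewrite inE => /eqP ->.
rewrite /compositions comps_fuelS => /flatten_mapP[j].
rewrite mem_iota => /andP[j0 _] /mapP[d d_in ->].
have le_j := leq_subS n j0.
move: d_in; rewrite comps_fuelE // inE => d_in /orP[/eqP->//|].
exact: IHn d_in.
Qed.

Lemma compositions_sum n c : c \in compositions n -> sumn c = n.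
Proof.
elim/ltn_ind: n c => -[|n] IHn c; first by rewrite inE => /eqP ->.
rewrite /compositions comps_fuelS => /flatten_mapP[j].
rewrite mem_iota => /andP[j0 le_j] /mapP[d d_in ->] /=.
have le_j' := leq_subS n j0.
by move: d_in; rewrite comps_fuelE // => /IHn ->; rewrite // subnKC.
Qed.

(** The integer top entry is negative only for [r = m = 0], where both binomials are 1, so truncated
    subtraction is harmless. *)
Lemma binomzE r m : binomz ((r.+1 + m)%:Z - 2) m = 'C((r + m).-1, m)%:Z.
Proof.
case: m => [|m]; first by case: (_ - _) => n; rewrite /= !bin0 ?mulr1.
have -> : (r.+1 + m.+1)%:Z - 2 = (r + m)%:Z :> int by rewrite addSnnS addnS addnS; ring.
by rewrite /= addnS.
Qed.

Section Gamma.
Variables (E : fieldType) (N : nat -> E).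

(* The coefficient of [T^w] in [(1 - N_1 T - N_2 T^2 - ...)^(-r)]. *)
Definition gamma r w : E :=
  \sum_(c <- compositions w) 'C((r + size c).-1, size c)%:R * \prod_(i <- c) N i.

Lemma gamma0 w : gamma 0 w = (w == 0)%:R.
Proof.
case: w => [|w]; first by rewrite /gamma big_compositions0 /= bin0 big_nil mulr1.
rewrite /gamma big_compositionsS big1 // => i _; rewrite big1 // => c _.
by rewrite /= bin_small ?mul0r.
Qed.

Lemma gamma_top r : gamma r 0 = 1.
Proof. by rewrite /gamma big_compositions0 /= bin0 big_nil mulr1. Qed.

(** With [P = 1 - N_1 T - N_2 T^2 - ...], this is [P^(-r-1) P = P^(-r)] read off on coefficients. It
    holds term by term, by Pascal's rule, once the first part of the composition is split off. *)
Lemma gammaS r w :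
  gamma r.+1 w = gamma r w + \sum_(i < w) N i.+1 * gamma r.+1 (w - i.+1).
Proof.
case: w => [|w]; first by rewrite big_ord0 addr0 !gamma_top.
rewrite /gamma !big_compositionsS -big_split /=; apply: eq_bigr => i _.
rewrite mulr_sumr -big_split /=; apply: eq_bigr => c _.
by rewrite big_cons addnS binS natrD; ring.
Qed.

End Gamma.

(* Comparison of coefficients in [sum_v 1 / (z + v - T) = 1 / (e z - e T)], where
   [e T = T / (1 - N_1 T - N_2 T^2 - ...)] and [N = nzsum iota fl]. *)
Lemma fsig_gamma (F : finFieldType) (E : fieldType) (iota : {rmorphism F -> E}) fl z n :
  fvalid F fl -> fexp F fl z != 0 ->
  fsig iota fl n.+1 z =
  \sum_(r < n.+1) (fexp F fl z) ^- r.+1 * gamma (nzsum iota fl) r (n - r).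
Proof.
move=> fl_ok z0; elim/ltn_ind: n => -[_|n IHn].
  by rewrite big_ord1 (fsig1 iota) // gamma_top mulr1 expr1.
rewrite fsig_rec // (fsig1 iota) //; set s := fexp F fl z; set N := nzsum iota fl.
(* For positive [m], [tau m] is the asserted value of [fsig iota fl m z]; it remains to see that
   [tau] satisfies the recursion [fsig_rec]. *)
pose tau m := \sum_(r < m) s ^- r.+1 * gamma N r (m.-1 - r).
have tauS m : tau m.+1 = s^-1 * (m == 0%N)%:R + \sum_(r < m) s ^- r.+2 * gamma N r.+1 (m - r.+1).
  by rewrite /tau big_ord_recl /= subn0 expr1 gamma0.
have sig_tau m : (m <= n)%N -> fsig iota fl m.+1 z = tau m.+1 by move=> ?; rewrite IHn.
rewrite -[RHS]/(tau n.+2) tauS mulr0 add0r.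
have -> : \sum_(r < n.+1) s ^- r.+2 * gamma N r.+1 (n.+1 - r.+1) =
  s^-1 * tau n.+1 + \sum_(i < n.+1) N i.+1 * (\sum_(r < n - i) s ^- r.+2 * gamma N r.+1 (n - i - r.+1)).
  under eq_bigr do rewrite subSS gammaS mulrDr.
  rewrite big_split /=; congr (_ + _).
    by rewrite /tau mulr_sumr; apply: eq_bigr => r _; rewrite exprS invfM mulrA.
  under eq_bigr => r _.
    rewrite (big_ord_widen n.+1 (fun i => N i.+1 * gamma N r.+1 (n - r - i.+1))) 1?leqW ?leq_subr //.
    rewrite mulr_sumr; over.
  rewrite (exchange_big_dep xpredT) //=; apply: eq_bigr => i _.
  rewrite (big_ord_widen n.+1 (fun r => s ^- r.+2 * gamma N r.+1 (n - i - r.+1))) 1?leqW ?leq_subr //.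
  rewrite mulr_sumr; apply: eq_big => [r|r _]; first by rewrite !ltn_subRL addnC.
  by rewrite mulrCA -!subnDA addnC addSnnS addnC.
rewrite sig_tau // mulrBr -addrA; congr (_ + _).
(* The last term [i = n] of the recursion, [N n.+1] times [fsig 1], cancels the subtracted
   product. *)
rewrite !big_ord_recr /= subSnn subnn big_ord0 mulr0 addr0 (fsig1 iota) // -/s.
rewrite [N _ * _]mulrC addrCA addNr addr0; apply: eq_bigr => i _.
have lt_in := ltn_ord i; have ni0 : (n - i != 0)%N by rewrite subn_eq0 -ltnNge.
by rewrite subSn 1?ltnW // sig_tau ?leq_subr // tauS (negPf ni0) mulr0 add0r.
Qed.

(** * Concatenation of flags *)

Section FlagConcatenation.
Variables (F : finFieldType) (E : fieldType) (iota : {rmorphism F -> E}).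
Local Notation q := #|F|.
Implicit Types (fl : seq (E * nat)) (z : E).

(** The image of [fl'] modulo the span of [fl], the quotient being realised inside [E] by the linear
    map [fexp F fl]; the exponents are kept. *)
Definition fquot fl fl' : seq (E * nat) := [seq (fexp F fl x.1, x.2) | x <- fl'].

Lemma fexp_cat fl' fl z : fexp F (fl' ++ fl) z = fexp F (fquot fl fl') (fexp F fl z).
Proof. by elim: fl' z => [|x fl' IH] z //=; rewrite !IH. Qed.

Lemma fvalid_cat fl' fl : fvalid F (fl' ++ fl) = fvalid F (fquot fl fl') && fvalid F fl.
Proof. by elim: fl' => [|x fl' IH] //=; rewrite IH fexp_cat andbA. Qed.

Lemma fquot_cat fl fl' fl'' : fquot (fl' ++ fl) fl'' = fquot (fquot fl fl') (fquot fl fl'').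
Proof. by rewrite /fquot -map_comp; apply: eq_map => x /=; rewrite fexp_cat. Qed.

Lemma fspan_quot fl fl' : fspan iota (fquot fl fl') = map (fexp F fl) (fspan iota fl').
Proof.
elim: fl' => [|x fl' IH] /=; first by rewrite (fexp0 iota).
rewrite IH map_allpairs; apply: (congr1 flatten); apply: eq_map => c.
by rewrite -map_comp; apply: eq_map => v /=; rewrite (fexpD iota) fexpZ.
Qed.

Lemma big_fspan_cat fl' fl (phi : E -> E) :
  \sum_(v <- fspan iota (fl' ++ fl)) phi v =
  \sum_(v <- fspan iota fl') \sum_(w <- fspan iota fl) phi (v + w).
Proof.
elim: fl' phi => [|x fl' IH] phi.
  by rewrite big_seq1; apply: eq_bigr => w _; rewrite add0r.
rewrite cat_cons !big_fspan_cons; apply: eq_bigr => c _.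
rewrite IH; apply: eq_bigr => v _; apply: eq_bigr => w _.
by rewrite addrA.
Qed.

(** The inner sum over the span of [fl] is expanded in powers of [1 / fexp] by [fsig_gamma]. By
    additivity of [fexp], the outer sum then runs over the span of the quotient flag. The [gamma]
    factors are what the brackets in Δ(x_n) must produce. *)
Lemma fsig_cat fl' fl z n : fvalid F (fl' ++ fl) -> fexp F (fl' ++ fl) z != 0 ->
  fsig iota (fl' ++ fl) n.+1 z =
  \sum_(r < n.+1) gamma (nzsum iota fl) r (n - r) * fsig iota (fquot fl fl') r.+1 (fexp F fl z).
Proof.
rewrite fvalid_cat fexp_cat => /andP[fl'_ok fl_ok] z0.
rewrite {1}/fsig big_fspan_cat [LHS]big_seq.
under eq_bigr => v v_in.
  under eq_bigr do rewrite addrA.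
  have zv : fexp F fl (z + v) != 0.
    rewrite (fexpD iota); apply: (@fexp_neq0 _ _ iota) z0.
    by rewrite fspan_quot map_f.
  rewrite -/(fsig iota fl n.+1 _) (fsig_gamma _ _ fl_ok zv); over.
rewrite -big_seq exchange_big /=; apply: eq_bigr => r _.
rewrite -mulr_suml mulrC; congr (_ * _).
by rewrite /fsig fspan_quot big_map; apply: eq_bigr => v _; rewrite (fexpD iota).
Qed.

Fixpoint fexp_poly fl : {poly E} :=
  if fl is x :: fl' then fexp_poly fl' - (fexp F fl' x.1 ^- q.-1) *: fexp_poly fl' ^+ q else 'X.

Lemma horner_fexp_poly fl z : (fexp_poly fl).[z] = fexp F fl z.
Proof.
elim: fl => [|x fl IH] /=; first by rewrite hornerX.
by rewrite hornerD hornerN hornerZ horner_exp IH mulrC.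
Qed.

(** The q-th powers have derivative 0 because [q = 0] in [E]. It follows that the polynomial is not
    constant. *)
Lemma deriv_fexp_poly fl : (fexp_poly fl)^`() = 1.
Proof.
elim: fl => [|x fl IH] /=; first by rewrite derivX.
rewrite derivB derivZ deriv_exp IH mul1r -mulr_natr.
by rewrite -polyC_natr (natr_card0 iota) mulr0 scaler0 subr0.
Qed.

Lemma size_fexp_poly fl : (1 < size (fexp_poly fl))%N.
Proof.
rewrite ltnNge; apply/negP => /size1_polyC fl1.
by have := deriv_fexp_poly fl; rewrite fl1 derivC => /esym/eqP; rewrite oner_eq0.
Qed.

Lemma infinite_nonroot (emb : nat -> E) (p : {poly E}) : injective emb -> p != 0 ->
  exists z, p.[z] != 0.
Proof.
move=> emb_inj p0; pose s := mkseq emb (size p).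
have [p_roots|] := boolP (all (root p) s).
  have := max_poly_roots p0 p_roots; rewrite map_inj_uniq // iota_uniq => /(_ isT).
  by rewrite size_map size_iota ltnn.
by case/allPn => z _ pz; exists z.
Qed.

(* [1 / fexp fl z] takes infinitely many values. *)
Lemma fexp_generic (emb : nat -> E) fl (p : {poly E}) : injective emb -> p != 0 ->
  exists2 z, fexp F fl z != 0 & p.[(fexp F fl z)^-1] != 0.
Proof.
move=> emb_inj p0.
(* The reversed polynomial times [X]: its value at nonzero [y] is [y^(size p) p(1/y)], and the
   factor [X] forces a nonroot to satisfy [y != 0]. *)
pose r : {poly E} := 'X * \poly_(i < size p) p`_(size p - i.+1).
have p_size : (0 < size p)%N by rewrite lt0n size_poly_eq0.
have r0 : r != 0.
  rewrite mulf_neq0 ?polyX_eq0 //; apply/eqP => /polyP/(_ 0%N).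
  rewrite coef_poly p_size coef0 subn1 => /eqP.
  by rewrite -lead_coefE lead_coef_eq0 (negPf p0).
have [|z] := infinite_nonroot emb_inj (p := r \Po fexp_poly fl).
  by rewrite comp_poly_eq0 ?size_fexp_poly.
rewrite horner_comp horner_fexp_poly hornerM hornerX mulf_eq0 negb_or => /andP[y0].
set y := fexp F fl z in y0 *; rewrite horner_poly => ry; exists z => //.
apply: contra_neq ry => py.
suff -> : \sum_(i < size p) p`_(size p - i.+1) * y ^+ i = y ^+ (size p).-1 * p.[y^-1].
  by rewrite py mulr0.
rewrite horner_coef mulr_sumr [RHS](reindex_inj rev_ord_inj) /=.
apply: eq_bigr => i _; rewrite mulrCA; congr (_ * _).
have le_i : (i <= (size p).-1)%N by rewrite -ltnS prednK.
rewrite -[X in _ = y ^+ X * _](subnKC le_i) exprD exprVn -subn1 -subnDA add1n.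
by rewrite mulfK // expf_neq0.
Qed.

End FlagConcatenation.

(** * Linear extension from a basis *)

Section LinearExtension.
Variables (R : comNzRingType) (K : choiceType).

Section Lext.
Variables (V : lmodType R) (f : K -> V).

Lemma lextEw (d : {fset K}) (g : {malg R[K]}) : (msupp g `<=` d)%fset ->
  lext f g = \sum_(k <- d) g@_k *: f k.
Proof.
move=> le_gd; rewrite /lext (big_fset_incl _ le_gd) // => k _ /mcoeff_outdom ->.
by rewrite scale0r.
Qed.

Lemma lext_linear : linear (lext f).
Proof.
move=> c g h; pose d := (msupp (c *: g + h) `|` msupp g `|` msupp h)%fset.
have sub1 : (msupp (c *: g + h) `<=` d)%fset by rewrite /d -fsetUA fsubsetUl.
have sub2 : (msupp g `<=` d)%fset by rewrite /d fsetUAC fsubsetUr.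
have sub3 : (msupp h `<=` d)%fset by rewrite /d fsubsetUr.
rewrite (lextEw sub1) (lextEw sub2) (lextEw sub3) scaler_sumr -big_split /=.
by apply: eq_bigr => k _; rewrite mcoeffD mcoeffZ scalerDl scalerA.
Qed.

HB.instance Definition _ := GRing.isLinear.Build R {malg R[K]} V _ (lext f) lext_linear.

Lemma lextU k : lext f << k >> = f k.
Proof. by rewrite (lextEw msuppU_le) big_seq_fset1 mcoeffUU scale1r. Qed.

End Lext.

Lemma eq_lext_in (V : lmodType R) (f f' : K -> V) (g : {malg R[K]}) :
  {in msupp g, f =1 f'} -> lext f g = lext f' g.
Proof.
move=> eq_ff; rewrite /lext big_seq [RHS]big_seq; apply: eq_bigr => k k_in.
by rewrite eq_ff.
Qed.

Lemma eq_lext (V : lmodType R) (f f' : K -> V) (g : {malg R[K]}) :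
  f =1 f' -> lext f g = lext f' g.
Proof. by move=> eq_ff; apply: eq_lext_in => k _. Qed.

Lemma lextP (V : lmodType R) (f : K -> V) (c : R) (g : K -> V) (x : {malg R[K]}) :
  lext (fun k => c *: f k + g k) x = c *: lext f x + lext g x.
Proof.
rewrite /lext scaler_sumr -big_split; apply: eq_bigr => k _.
by rewrite scalerDr !scalerA mulrC.
Qed.

Lemma linear_lext (V W : lmodType R) (phi : V -> W) (f : K -> V) (g : {malg R[K]}) :
  linear phi -> phi (lext f g) = lext (fun k => phi (f k)) g.
Proof.
move=> phi_lin.
pose phiL := GRing.isLinear.Build R V W _ phi phi_lin.
pose psi : {linear V -> W} := HB.pack phi phiL.
rewrite -[phi]/(psi : V -> W) /lext linear_sum; apply: eq_bigr => k _.
by rewrite linearZ.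
Qed.

Lemma lext_basis (g : {malg R[K]}) : lext (fun k => << k >>) g = g.
Proof.
rewrite [RHS]monalgE; apply: eq_bigr => k _; apply/malgP => k'.
by rewrite mcoeffZ !mcoeffU mulr_natr.
Qed.

Lemma linear_ext (V : lmodType R) (phi psi : {malg R[K]} -> V) :
  linear phi -> linear psi -> (forall k, phi << k >> = psi << k >>) -> phi =1 psi.
Proof.
move=> phi_lin psi_lin eq_pp x; rewrite -[x]lext_basis.
by rewrite !linear_lext //; apply: eq_lext.
Qed.

Definition supported (P : pred K) (g : {malg R[K]}) := forall k, k \in msupp g -> P k.

Lemma supported0 (P : pred K) : supported P 0.
Proof. by move=> k; rewrite msupp0. Qed.

Lemma supportedU (P : pred K) k : P k -> supported P << k >>.
Proof.
move=> Pk k'; rewrite -mcoeff_neq0 mcoeffU.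
by case: (k =P k') => [<-|_] //; rewrite mulr0n eqxx.
Qed.

Lemma supportedD (P : pred K) g h : supported P g -> supported P h -> supported P (g + h).
Proof. by move=> Pg Ph k /(fsubsetP (msuppD_le _ _)); rewrite in_fsetU => /orP[/Pg|/Ph]. Qed.

Lemma supportedZ (P : pred K) c g : supported P g -> supported P (c *: g).
Proof. by move=> Pg k /(fsubsetP (msuppZ_le _ _)) /Pg. Qed.

Lemma supported_sum (P : pred K) (I : eqType) (r : seq I) (f : I -> {malg R[K]}) :
  {in r, forall i, supported P (f i)} -> supported P (\sum_(i <- r) f i).
Proof.
move=> Pf; rewrite big_seq; elim/big_ind: _ => [|g h|//]; first exact: supported0.
exact: supportedD.
Qed.

End LinearExtension.

Lemma supported_lext (R : comNzRingType) (K K' : choiceType) (P : pred K)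
    (f : K' -> {malg R[K]}) (g : {malg R[K']}) :
  {in msupp g, forall k, supported P (f k)} -> supported P (lext f g).
Proof. by move=> Pf; apply: supported_sum => k k_in; apply/supportedZ/Pf. Qed.

(** * Extension of [E]-valued functions from a basis *)

Section Evaluation.
Variables (F E : fieldType) (iota : {rmorphism F -> E}).

(** The counterpart of [lext] for values in [E], on which [F] acts through [iota]. *)
Definition vext (K : choiceType) (phi : K -> E) (g : {malg F[K]}) : E :=
  \sum_(k <- msupp g) iota g@_k * phi k.

Section Vext.
Variables (K : choiceType) (phi : K -> E).
Implicit Types g h : {malg F[K]}.

Lemma vextEw (d : {fset K}) g : (msupp g `<=` d)%fset ->
  vext phi g = \sum_(k <- d) iota g@_k * phi k.
Proof.
move=> le_gd; rewrite /vext (big_fset_incl _ le_gd) // => k _ /mcoeff_outdom ->.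
by rewrite rmorph0 mul0r.
Qed.

Lemma vextP c g h : vext phi (c *: g + h) = iota c * vext phi g + vext phi h.
Proof.
pose d := (msupp (c *: g + h) `|` msupp g `|` msupp h)%fset.
have sub1 : (msupp (c *: g + h) `<=` d)%fset by rewrite /d -fsetUA fsubsetUl.
have sub2 : (msupp g `<=` d)%fset by rewrite /d fsetUAC fsubsetUr.
have sub3 : (msupp h `<=` d)%fset by rewrite /d fsubsetUr.
rewrite (vextEw sub1) (vextEw sub2) (vextEw sub3) mulr_sumr -big_split /=.
by apply: eq_bigr => k _; rewrite mcoeffD mcoeffZ rmorphD rmorphM mulrDl mulrA.
Qed.

Lemma vextZ c g : vext phi (c *: g) = iota c * vext phi g.
Proof. by rewrite -[c *: g]addr0 vextP /vext msupp0 big_seq_fset0 addr0. Qed.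

Lemma vextD g h : vext phi (g + h) = vext phi g + vext phi h.
Proof. by rewrite -[g]scale1r vextP rmorph1 mul1r scale1r. Qed.

Lemma vextB g h : vext phi (g - h) = vext phi g - vext phi h.
Proof. by rewrite vextD -scaleN1r vextZ rmorphN1 mulN1r. Qed.

Lemma vext_sum I (r : seq I) (f : I -> {malg F[K]}) :
  vext phi (\sum_(i <- r) f i) = \sum_(i <- r) vext phi (f i).
Proof.
elim: r => [|i r IH]; last by rewrite !big_cons vextD IH.
by rewrite !big_nil /vext msupp0 big_seq_fset0.
Qed.

Lemma vextU k : vext phi << k >> = phi k.
Proof. by rewrite (vextEw msuppU_le) big_seq_fset1 mcoeffUU rmorph1 mul1r. Qed.

Lemma vext_lext (K' : choiceType) (f : K' -> {malg F[K]}) (g : {malg F[K']}) :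
  vext phi (lext f g) = vext (fun k => vext phi (f k)) g.
Proof. by rewrite vext_sum; apply: eq_bigr => k _; rewrite vextZ. Qed.

Lemma eq_vext_in (psi : K -> E) g : {in msupp g, phi =1 psi} -> vext phi g = vext psi g.
Proof.
move=> eq_pp; rewrite /vext big_seq [RHS]big_seq; apply: eq_bigr => k k_in.
by rewrite eq_pp.
Qed.

Lemma eq_vext (psi : K -> E) g : phi =1 psi -> vext phi g = vext psi g.
Proof. by move=> eq_pp; apply: eq_vext_in => k _. Qed.

Lemma vext_mull (a : E) g : vext (fun k => a * phi k) g = a * vext phi g.
Proof. by rewrite /vext mulr_sumr; apply: eq_bigr => k _; rewrite mulrCA. Qed.

Lemma vext_mulr (a : E) g : vext (fun k => phi k * a) g = vext phi g * a.
Proof. by rewrite /vext mulr_suml; apply: eq_bigr => k _; rewrite mulrA. Qed.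

Lemma vext_add (psi : K -> E) g : vext (fun k => phi k + psi k) g = vext phi g + vext psi g.
Proof. by rewrite /vext -big_split; apply: eq_bigr => k _; rewrite mulrDr. Qed.

End Vext.
End Evaluation.

(** * Evaluation of words at flags *)

Section Shuffle.
Variable F : finFieldType.
Local Notation letter := (letter F).
Local Notation word := (word F).
Local Notation D := {malg F[word]}.
Implicit Types (x y : letter) (a b w : word).

Lemma lw_gt0 x : (0 < lw x)%N.
Proof. by have /andP[] := valP x. Qed.

Lemma lc_neq0 x : lc x != 0.
Proof. by have /andP[] := valP x. Qed.

Lemma lw_L n (e : F) : (0 < n)%N -> e != 0 -> lw (L n e) = n.
Proof. by move=> n0 e0; rewrite /lw /L insubdK //= unfold_in /= n0. Qed.

Lemma lc_L n (e : F) : (0 < n)%N -> e != 0 -> lc (L n e) = e.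
Proof. by move=> n0 e0; rewrite /lc /L insubdK //= unfold_in /= n0. Qed.

Lemma letter_inj x y : lw x = lw y -> lc x = lc y -> x = y.
Proof.
move=> eq_w eq_c; apply: val_inj.
by rewrite [val x]surjective_pairing [val y]surjective_pairing; congr pair.
Qed.

Lemma weight_nil : weight ([::] : word) = 0%N.
Proof. by []. Qed.

Lemma weight_cons x w : weight (x :: w) = (lw x + weight w)%N.
Proof. by []. Qed.

(** The size bound controls the fuel of nested shuffles; the exact weight gives the grading. *)
Definition bounded n m : pred word := fun w => (size w <= n)%N && (weight w == m).

Lemma supported_lcons x n m (v : D) :
  supported (bounded n m) v -> supported (bounded n.+1 (lw x + m)%N) (lcons x v).
Proof.
move=> v_supp; apply: supported_lext => w /v_supp /andP[w_size /eqP w_wt].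
by apply: supportedU; rewrite /bounded weight_cons w_wt eqxx andbT.
Qed.

Lemma sh_fuel_supported n a b :
  supported (bounded (size a + size b)%N (weight a + weight b)%N) (sh_fuel n a b).
Proof.
elim: n a b => [|n IHn] a b; first exact: supported0.
case: a => [|x a]; first by apply: supportedU; rewrite /bounded leqnn eqxx.
case: b => [|y b].
  by apply: supportedU; apply/andP; rewrite addn0 leqnn; split=> //; rewrite weight_nil addn0.
apply: supportedD; first apply: supportedD.
- have := supported_lcons (x := x) (IHn a (y :: b)).
  by rewrite addnA -weight_cons.
- have := supported_lcons (x := y) (IHn (x :: a) b).
  by rewrite addnCA -weight_cons -addnS.
have ab_supp := IHn a b.
apply: supportedD.
  move=> w /(supported_lcons ab_supp); rewrite /bounded.
  rewrite lw_L ?addn_gt0 ?lw_gt0 ?mulf_neq0 ?lc_neq0 // !weight_cons addnACA => /andP[w_size ->].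
  by rewrite andbT (leq_trans w_size) // addSn ltnS leq_add2l.
apply: supported_sum => j; rewrite mem_iota => /andP[j0 le_j].
have lt_j : (j < lw x + lw y)%N by move: le_j; rewrite add1n prednK // addn_gt0 lw_gt0.
apply: supportedZ.
have : supported (bounded (size a + size b).+1 (j + (weight a + weight b))%N)
    (lext (sh_fuel n [:: L j 1]) (sh_fuel n a b)).
  apply: supported_lext => w /ab_supp /andP[w_size /eqP w_wt] v /IHn /andP[v_size /eqP v_wt].
  rewrite /bounded (leq_trans v_size) //= v_wt weight_cons w_wt lw_L ?oner_neq0 //.
  by rewrite weight_nil addn0 eqxx.
move=> /(supported_lcons (x := L (lw x + lw y - j)%N (lc x * lc y))).
rewrite lw_L ?subn_gt0 ?mulf_neq0 ?lc_neq0 // addnA subnK ?(ltnW lt_j) //.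
by rewrite addnACA -!weight_cons -addSn -addnS.
Qed.

Section WordEvaluation.
Variables (E : fieldType) (iota : {rmorphism F -> E}).
Local Notation q := #|F|.
Implicit Types (fl : seq (E * nat)) (s : E * nat).

(** The sum over [d_1 > ... > d_r] is split by whether the first letter sits at the top vector [s];
    [wtop] is the contribution in which it does. *)
Fixpoint wev fl w : E :=
  if fl is s :: fl' then
    wev fl' w +
    (if w is x :: w' then iota (lc x) ^+ s.2 * fsig iota fl' (lw x) s.1 * wev fl' w' else 0)
  else (w == [::])%:R.

Definition wtop s fl w : E :=
  if w is x :: w' then iota (lc x) ^+ s.2 * fsig iota fl (lw x) s.1 * wev fl w' else 0.

Lemma wev_cons s fl w : wev (s :: fl) w = wev fl w + wtop s fl w.
Proof. by []. Qed.

Lemma wev_nil fl : wev fl [::] = 1.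
Proof. by elim: fl => [|s fl IH] //=; rewrite IH addr0. Qed.

Lemma vext_wev_cons s fl (u : D) :
  vext iota (wev (s :: fl)) u = vext iota (wev fl) u + vext iota (wtop s fl) u.
Proof. exact: vext_add. Qed.

Lemma vext_wev_flag0 (u : D) : vext iota (wev [::]) u = iota u@_[::].
Proof.
rewrite (@vextEw _ _ _ _ _ ([::] |` msupp u)%fset) ?fsubsetUr //.
rewrite (big_fsetD1 [::]) /= ?in_fset1U ?eqxx // mulr1 big1_fset ?addr0 // => w.
by rewrite in_fsetD1 => /andP[/negPf-> _]; rewrite mulr0.
Qed.

Lemma vext_wtop_lcons s fl x (v : D) :
  vext iota (wtop s fl) (lcons x v) =
  iota (lc x) ^+ s.2 * fsig iota fl (lw x) s.1 * vext iota (wev fl) v.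
Proof.
rewrite vext_lext -vext_mull; apply: eq_vext => w.
by rewrite vextU.
Qed.

Lemma wev_letter1 fl j : (0 < j)%N -> wev fl [:: L j 1] = \sum_(m <- fmonic iota fl) m ^- j.
Proof.
move=> j0; elim: fl => [|s fl IH]; first by rewrite big_nil.
rewrite wev_cons IH /= lc_L ?oner_neq0 // rmorph1 expr1n mul1r lw_L ?oner_neq0 //.
by rewrite wev_nil mulr1 big_cat big_map addrC.
Qed.

(** Both sides vanish unless [q - 1] divides [j]. If it does, [x_j] evaluates to the sum over monic
    elements, which is [- nzsum] by [fnz_expr]. *)
Lemma Dcoef_nzsum fl j n m : (0 < j)%N ->
  iota (Dcoef F j n m) * wev fl [:: L j 1] =
  - ((-1) ^+ n.-1 * 'C(j.-1, n.-1)%:R + (-1) ^+ m.-1 * 'C(j.-1, m.-1)%:R) * nzsum iota fl j.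
Proof.
move=> j0; rewrite /Dcoef /nzsum fnz_expr wev_letter1 // /qF; case: ifP => _.
  by rewrite rmorphD !rmorphM !rmorphXn !rmorphN1 !rmorph_nat; ring.
by rewrite rmorph0 mul0r mulr0.
Qed.

Lemma sh_fuelS n x a y b : sh_fuel n.+1 (x :: a) (y :: b) =
  lcons x (sh_fuel n a (y :: b)) + lcons y (sh_fuel n (x :: a) b) + dm_with (sh_fuel n) x a y b.
Proof. by []. Qed.

(** The diamond product accounts for both first letters sitting at the same top vector, where
    [fsig_mul] applies. The shuffle is a parameter so that the lemma can be used at reduced fuel
    inside the induction. *)
Lemma vext_wtop_dm (sh : word -> word -> D) s fl x a y b : fvalid F (s :: fl) ->
  {in msupp (sh a b), forall w j, (0 < j)%N ->
    vext iota (wev fl) (sh [:: L j 1] w) = wev fl [:: L j 1] * wev fl w} ->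
  vext iota (wtop s fl) (dm_with sh x a y b) =
  iota (lc x) ^+ s.2 * fsig iota fl (lw x) s.1 * (iota (lc y) ^+ s.2 * fsig iota fl (lw y) s.1)
  * vext iota (wev fl) (sh a b).
Proof.
move=> /andP[s0 fl_ok] sh_j; rewrite /dm_with; set S := sh a b; cbv zeta.
have [v vE] : exists v, vext iota (wev fl) S = v by eexists.
rewrite vE.
have [n nE] : exists n, lw x = n.+1 by exists (lw x).-1; rewrite prednK ?lw_gt0.
have [m mE] : exists m, lw y = m.+1 by exists (lw y).-1; rewrite prednK ?lw_gt0.
have c0 : lc x * lc y != 0 by rewrite mulf_neq0 ?lc_neq0.
rewrite vextD vext_wtop_lcons vext_sum lc_L ?lw_L ?addn_gt0 ?lw_gt0 // vE nE mE addSn /=.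
rewrite (big_iota1 _ (fun j => vext _ _ _)).
have -> : iota (lc x) ^+ s.2 * fsig iota fl n.+1 s.1 * (iota (lc y) ^+ s.2 * fsig iota fl m.+1 s.1) =
  iota (lc x * lc y) ^+ s.2 * (fsig iota fl n.+1 s.1 * fsig iota fl m.+1 s.1).
  by rewrite rmorphM exprMn mulrACA.
rewrite fsig_mul // addnS mulrBr mulrBl; congr (_ + _).
rewrite mulr_sumr mulr_suml -sumrN; apply: eq_bigr => j _.
rewrite vextZ vext_wtop_lcons lc_L ?lw_L ?subn_gt0 ?ltnS //; try by rewrite -ltnS.
have -> : vext iota (wev fl) (lext (fun w => sh [:: L j.+1 1] w) S) = wev fl [:: L j.+1 1] * v.
  by rewrite vext_lext -vE -vext_mull; apply: eq_vext_in => w w_in; rewrite sh_j.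
have := Dcoef_nzsum fl n.+1 m.+1 (ltn0Sn j).
set d := iota _; set g := wev _ _ => dgE.
transitivity (iota (lc x * lc y) ^+ s.2 * fsig iota fl ((n + m).+1 - j) s.1 * v * (d * g)).
  by rewrite subSS; ring.
by rewrite dgE /=; ring.
Qed.

Lemma sh_fuel_nil n a : (sh_fuel n.+1 [::] a = << a >>) * (sh_fuel n.+1 a [::] = << a >>).
Proof. by split=> //; case: a. Qed.

Lemma wev_flag0_cons x a : wev [::] (x :: a) = 0.
Proof. by []. Qed.


(** Induction on the fuel, then on the flag. Writing the two values as [A + A'] and [B + B'] with
    [A', B'] the [wtop] parts, the inner induction gives [A B], and the three summands of the
    recursion give [A' B], [A B'] and [A' B']. *)
Lemma sh_fuel_wev n a b fl : (size a + size b < n)%N -> fvalid F fl ->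
  vext iota (wev fl) (sh_fuel n a b) = wev fl a * wev fl b.
Proof.
elim: n a b fl => // n IHn a b fl lt_ab fl_ok.
case: a lt_ab => [|x a] lt_ab; first by rewrite sh_fuel_nil vextU wev_nil mul1r.
case: b lt_ab => [|y b] lt_ab; first by rewrite sh_fuel_nil vextU wev_nil mulr1.
rewrite addSn ltnS in lt_ab.
have lt_xb : (size (x :: a) + size b < n)%N by rewrite addSn -addnS.
have lt_a_b : (size a + size b < n)%N by rewrite ltnW // -addnS.
elim: fl fl_ok => [_|s fl IHfl fl_ok].
  rewrite vext_wev_flag0 wev_flag0_cons mul0r -(rmorph0 iota); congr (iota _).
  (* At the empty flag only the coefficient of the empty word counts; it vanishes because the
     shuffle has positive weight. *)
  suff Hs : supported (fun w => w != [::]) (sh_fuel n.+1 (x :: a) (y :: b)).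
    by apply/eqP; rewrite mcoeff_eq0; apply/negP => /Hs.
  move=> w /sh_fuel_supported /andP[_]; apply: contraTneq => ->.
  by rewrite eq_sym -lt0n weight_cons -addnA ltn_addr // lw_gt0.
have /andP[s0 fl_ok'] := fl_ok.
have E1 : vext iota (wtop s fl) (lcons x (sh_fuel n a (y :: b))) =
    wtop s fl (x :: a) * wev fl (y :: b).
  by rewrite vext_wtop_lcons IHn // mulrA.
have E2 : vext iota (wtop s fl) (lcons y (sh_fuel n (x :: a) b)) =
    wtop s fl (y :: b) * wev fl (x :: a).
  by rewrite vext_wtop_lcons IHn // [wev fl (x :: a) * _]mulrC mulrA.
have E3 : vext iota (wtop s fl) (dm_with (sh_fuel n) x a y b) =
    wtop s fl (x :: a) * wtop s fl (y :: b).
  rewrite vext_wtop_dm //; first by rewrite IHn // mulrACA.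
  (* Words of the inner shuffle have at most [size a + size b] letters, so adjoining [x_j] still
     stays below the fuel [n]. *)
  move=> w /sh_fuel_supported /andP[w_size _] j j0; rewrite IHn //.
  by rewrite add1n (leq_ltn_trans _ lt_xb) // addSn ltnS.
rewrite vext_wev_cons IHfl // sh_fuelS vextD vextD.
rewrite [X in _ + (X + _ + _)]E1 [X in _ + (_ + X + _)]E2 [X in _ + (_ + _ + X)]E3.
rewrite (wev_cons s fl (x :: a)) (wev_cons s fl (y :: b)).
move: (wev fl (x :: a)) (wev fl (y :: b)) (wtop s fl (x :: a)) (wtop s fl (y :: b)) => A B A' B'.
ring.
Qed.

End WordEvaluation.
End Shuffle.

(** * The coproduct as evaluation at concatenated flags *)

Lemma prodrN_seq (R : comPzRingType) I (r : seq I) (f : I -> R) :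
  \prod_(i <- r) - f i = (-1) ^+ size r * \prod_(i <- r) f i.
Proof.
elim: r => [|i r IH]; first by rewrite !big_nil mulr1.
by rewrite !big_cons IH /= exprS; ring.
Qed.

Lemma leq_sumn (s : seq nat) i : i \in s -> (i <= sumn s)%N.
Proof.
elim: s => //= j s IH; rewrite inE => /orP[/eqP <-|/IH]; first exact: leq_addr.
by move=> le_i; apply: leq_trans le_i (leq_addl _ _).
Qed.

Section CoproductEvaluation.
Variables (F : finFieldType) (E : fieldType) (iota : {rmorphism F -> E}).
Local Notation letter := (letter F).
Local Notation word := (word F).
Local Notation D := {malg F[word]}.
Local Notation wev := (wev iota).
Implicit Types (x y : letter) (u v w : word) (fl : seq (E * nat)) (s : E * nat).

Lemma shw_wev fl v w : fvalid F fl -> vext iota (wev fl) (shw v w) = wev fl v * wev fl w.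
Proof. exact: sh_fuel_wev. Qed.

Lemma shuffle_wev fl (X Y : D) : fvalid F fl ->
  vext iota (wev fl) (shuffle X Y) = vext iota (wev fl) X * vext iota (wev fl) Y.
Proof.
move=> fl_ok; rewrite /shuffle /bilext vext_lext -vext_mulr; apply: eq_vext => v.
by rewrite vext_lext -vext_mull; apply: eq_vext => w; rewrite shw_wev.
Qed.

Lemma shuffle1r (X : D) : shuffle X << [::] >> = X.
Proof.
rewrite -[RHS]lext_basis; apply: eq_lext => w.
by rewrite lextU; case: w.
Qed.

(** A part [i] of a composition of [n] satisfies [i - 1 < n], so the second binomial of Δ^i_{1,n+1}
    vanishes and the first is 1. Each factor [-Δ^i x_i] therefore evaluates to [nzsum] at [i]. *)
Lemma brk_wev fl n c : fvalid F fl -> c \in compositions n ->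
  vext iota (wev fl) (brk F c) = \prod_(i <- c) nzsum iota fl i.
Proof.
move=> fl_ok c_in; have c_sum := compositions_sum c_in.
rewrite /brk vextZ c_sum rmorphM rmorphXn rmorphN1 rmorph_prod.
have -> : vext iota (wev fl) (foldr (fun i acc => shuffle << [:: L i 1] >> acc) (oneD F) c) =
  \prod_(i <- c) wev fl [:: L i 1].
  elim: c {c_in c_sum} => [|i c IHc]; first by rewrite big_nil vextU wev_nil.
  by rewrite big_cons /= shuffle_wev // vextU IHc.
rewrite -mulrA -big_split /= -prodrN_seq big_seq [RHS]big_seq; apply: eq_bigr => i i_in.
have i0 := compositions_gt0 c_in i_in.
have lt_in : (i.-1 < n)%N by rewrite prednK // -c_sum; exact: leq_sumn.
rewrite Dcoef_nzsum // expr0 mul1r bin0 addn1 /= bin_small // mulr0 addr0.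
by rewrite mulN1r opprK.
Qed.

Lemma sum_brk_wev fl n r : fvalid F fl ->
  \sum_(c <- compositions n) iota (binomz ((r.+1 + size c)%:Z - 2) (size c))%:~R *
    vext iota (wev fl) (brk F c) = gamma (nzsum iota fl) r n.
Proof.
move=> fl_ok; rewrite /gamma big_seq [RHS]big_seq; apply: eq_bigr => c c_in.
by rewrite (brk_wev fl_ok c_in) binomzE rmorph_int.
Qed.

(** The one-letter case of the definition is the general formula over Δ(1) = 1 ⊗ 1, which gives one
    recursion for all nonempty words. *)
Lemma cop_word_cons x v : cop_word (x :: v) = << ([::], x :: v) >> +
  \sum_(r <- seq.iota 1 (lw x)) \sum_(c <- compositions (lw x - r))
    (binomz ((r + size c)%:Z - 2) (size c))%:~R *:
      lext (fun p => tens_w (L r (lc x) :: p.1) (shuffle (brk F c) << p.2 >>)) (cop_word v).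
Proof.
case: v => [|y v]; last exact: erefl.
apply: (congr2 +%R erefl).
apply: eq_bigr => r _; apply: eq_bigr => c _.
by rewrite lextU shuffle1r.
Qed.

Definition wev2 fl' fl (p : word * word) : E := wev fl' p.1 * wev fl p.2.

Definition cop_ev fl' fl w : E := vext iota (wev2 fl' fl) (cop_word w).

Lemma vext_tens_w (phi psi : word -> E) u (X : D) :
  vext iota (fun p => phi p.1 * psi p.2) (tens_w u X) = phi u * vext iota psi X.
Proof. by rewrite vext_lext -vext_mull; apply: eq_vext => w; rewrite vextU. Qed.

Lemma cop_ev_cons fl' fl x v : fvalid F fl ->
  cop_ev fl' fl (x :: v) = wev fl (x :: v) +
  \sum_(r < lw x) \sum_(c <- compositions (lw x - r.+1))
    iota (binomz ((r.+1 + size c)%:Z - 2) (size c))%:~R * (vext iota (wev fl) (brk F c) *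
     vext iota (fun p => wev fl' (L r.+1 (lc x) :: p.1) * wev fl p.2) (cop_word v)).
Proof.
move=> fl_ok; rewrite /cop_ev cop_word_cons vextD vextU {1}/wev2 wev_nil mul1r.
congr (_ + _); rewrite vext_sum (big_iota1 _ (fun r => vext _ _ _)).
apply: eq_bigr => r _; rewrite vext_sum; apply: eq_bigr => c _.
rewrite vextZ vext_lext; congr (_ * _); rewrite -vext_mull; apply: eq_vext => p.
by rewrite vext_tens_w shuffle_wev // vextU mulrCA.
Qed.

(** The counterpart of [wev_cons]: the new terms are those where the first letter of the left tensor
    factor sits at [s]. What remains of that factor and the right one is Δ(v), and the brackets sum
    to [gamma]. *)
Lemma cop_ev_flag_cons s fl' fl x v : fvalid F fl ->
  cop_ev (s :: fl') fl (x :: v) = cop_ev fl' fl (x :: v) +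
  iota (lc x) ^+ s.2 * cop_ev fl' fl v *
  \sum_(r < lw x) gamma (nzsum iota fl) r (lw x - r.+1) * fsig iota fl' r.+1 s.1.
Proof.
move=> fl_ok; rewrite !cop_ev_cons // -addrA; congr (_ + _).
rewrite mulr_sumr -big_split /=; apply: eq_bigr => r _.
rewrite -sum_brk_wev // mulr_suml mulr_sumr -big_split /=; apply: eq_bigr => c _.
have -> : vext iota (fun p => wev (s :: fl') (L r.+1 (lc x) :: p.1) * wev fl p.2) (cop_word v) =
  vext iota (fun p => wev fl' (L r.+1 (lc x) :: p.1) * wev fl p.2) (cop_word v) +
  iota (lc x) ^+ s.2 * fsig iota fl' r.+1 s.1 * cop_ev fl' fl v.
  rewrite -vext_mull -vext_add; apply: eq_vext => p.
  rewrite wev_cons mulrDl /wtop lw_L ?lc_L ?lc_neq0 // -mulrA; congr (_ + _).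
ring.
Qed.

(** Induction on [fl']: by [fsig_cat], both sides change in the same way when a top vector is added.
    Over an empty [fl'] only the term 1 ⊗ w survives. *)
Lemma cop_ev_cat fl' fl w : fvalid F (fl' ++ fl) ->
  cop_ev (fquot F fl fl') fl w = wev (fl' ++ fl) w.
Proof.
elim: fl' w => [|s fl' IH] w.
  move=> fl_ok; case: w => [|x v]; first by rewrite /cop_ev vextU /wev2 !wev_nil mulr1.
  rewrite cop_ev_cons // big1 ?addr0 // => r _; rewrite big1 // => c _.
  by rewrite (@eq_vext _ _ _ _ _ (fun p => 0 * wev fl p.2)) // vext_mull mul0r !mulr0.
move=> /andP[s0 fl_ok].
have fl_ok2 : fvalid F fl by move: fl_ok; rewrite -/(fvalid F _) fvalid_cat => /andP[].
case: w => [|x v]; first by rewrite wev_nil /cop_ev vextU /wev2 !wev_nil mulr1.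
rewrite [fquot _ _ _]/= cop_ev_flag_cons // !IH // cat_cons wev_cons /wtop; congr (_ + _).
have [n nE] : exists n, lw x = n.+1 by exists (lw x).-1; rewrite prednK ?lw_gt0.
by rewrite nE fsig_cat //= mulrAC.
Qed.

Lemma coproduct_wev2 fl' fl (X : D) : fvalid F (fl' ++ fl) ->
  vext iota (wev2 (fquot F fl fl') fl) (coproduct X) = vext iota (wev (fl' ++ fl)) X.
Proof.
by move=> fl_ok; rewrite vext_lext; apply: eq_vext => w; exact: cop_ev_cat.
Qed.

End CoproductEvaluation.

(** * Evaluations separate words *)

Section FreeFamilies.
Variable E : fieldType.

Lemma big_subseq_ext (V : nmodType) (K : eqType) (s t : seq K) (f : K -> V) :
  uniq s -> uniq t -> {subset s <= t} ->
  \sum_(k <- s) f k = \sum_(k <- t) if k \in s then f k else 0.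
Proof.
move=> s_uniq t_uniq sub_st; rewrite -big_mkcond -big_filter.
apply: perm_big; apply: uniq_perm => //; first exact: filter_uniq.
by move=> k; rewrite mem_filter; case: (boolP (k \in s)) => // /sub_st.
Qed.

(* The functions [phi i], [i] ranging over [P], separate finite [E]-linear combinations
   of elements of [K]. *)
Definition separating (I : Type) (K : eqType) (P : I -> Prop) (phi : I -> K -> E) : Prop :=
  forall (s : seq K) (c : K -> E), uniq s ->
  (forall i, P i -> \sum_(k <- s) c k * phi i k = 0) -> {in s, forall k, c k = 0}.

(** For fixed [j] the first family is separated with coefficients [sum_b c(a, b) psi_j(b)], which
    lie in [E]; hence the coefficients in [separating] are taken there. Then [j] varies. The first
    family may depend on [j], as a quotient flag depends on the flag divided out. *)
Lemma separating_prod (I J : Type) (K1 K2 : eqType) (P : J -> Prop) (Q : J -> I -> Prop)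
    (phi : J -> I -> K1 -> E) (psi : J -> K2 -> E) :
  (forall j, P j -> separating (Q j) (phi j)) -> separating P psi ->
  separating (fun ij : J * I => P ij.1 /\ Q ij.1 ij.2)
    (fun ij (k : K1 * K2) => phi ij.1 ij.2 k.1 * psi ij.1 k.2).
Proof.
move=> sep1 sep2 s c s_uniq c0.
pose s1 := undup (map fst s); pose s2 := undup (map snd s).
pose c' k := if k \in s then c k else 0.
have sub_s : {subset s <= allpairs pair s1 s2}.
  by move=> [a b] ab_in; rewrite allpairs_f // mem_undup; apply/mapP; exists (a, b).
have t_uniq : uniq (allpairs pair s1 s2).
  by apply: allpairs_uniq; rewrite ?undup_uniq // => -[a b] [a' b'] _ _ [-> ->].
have c'0 j i : P j -> Q j i ->
    \sum_(a <- s1) (\sum_(b <- s2) c' (a, b) * psi j b) * phi j i a = 0.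
  move=> Pj Qi; rewrite -[RHS](c0 (j, i)) // (big_subseq_ext _ s_uniq t_uniq) //.
  rewrite big_allpairs_dep; apply: eq_bigr => a _; rewrite mulr_suml; apply: eq_bigr => b _ /=.
  by rewrite /c'; case: ifP => _; [ring|rewrite !mul0r].
have c'1 j a : P j -> a \in s1 -> \sum_(b <- s2) c' (a, b) * psi j b = 0.
  move=> Pj; move: a; apply: (sep1 j Pj s1); first exact: undup_uniq.
  by move=> i Qi; exact: c'0.
have c'2 a b : a \in s1 -> b \in s2 -> c' (a, b) = 0.
  move=> a_in; move: b; apply: (sep2 s2); first exact: undup_uniq.
  by move=> j Pj; exact: c'1.
move=> [a b] ab_in; have /allpairsP[[a' b'] /= [a_in b_in [aE bE]]] := sub_s _ ab_in.
by have := c'2 _ _ a_in b_in; rewrite -aE -bE /c' ab_in.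
Qed.

Lemma separating_vext (F : fieldType) (iota : {rmorphism F -> E}) (I : Type) (K : choiceType)
    (P : I -> Prop) (phi : I -> K -> E) (X Y : {malg F[K]}) :
  separating P phi -> (forall i, P i -> vext iota (phi i) X = vext iota (phi i) Y) -> X = Y.
Proof.
move=> sep eqXY; apply/eqP; rewrite -subr_eq0; apply/eqP/malgP => k.
rewrite mcoeff0; case: (msuppP (X - Y) k) => // k_in.
apply/eqP; rewrite -(fmorph_eq0 iota); apply/eqP.
apply: (sep (msupp (X - Y)) (fun k => iota (X - Y)@_k)) k_in; first exact: fset_uniq.
by move=> i Pi; rewrite -/(vext iota (phi i) (X - Y)) vextB eqXY ?subrr.
Qed.

End FreeFamilies.

Section WordsSeparated.
Variables (F : finFieldType) (E : fieldType) (iota : {rmorphism F -> E}) (emb : nat -> E).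
Hypothesis emb_inj : injective emb.
Local Notation letter := (letter F).
Local Notation word := (word F).
Local Notation wev := (wev iota).
Implicit Types (x y : letter) (u v w : word) (fl g : seq (E * nat)) (s : E * nat).

Definition fsig_poly fl n : {poly E} :=
  \poly_(r < n.+1) (if r is r'.+1 then gamma (nzsum iota fl) r' (n - r'.+1) else 0).

Lemma horner_fsig_poly fl n z : fvalid F fl -> fexp F fl z != 0 -> (0 < n)%N ->
  fsig iota fl n z = (fsig_poly fl n).[(fexp F fl z)^-1].
Proof.
case: n => // n fl_ok z0 _; rewrite horner_poly big_ord_recl mul0r add0r fsig_gamma //.
by apply: eq_bigr => r _; rewrite mulrC exprVn.
Qed.

Lemma fsig_poly_top fl n : (0 < n)%N -> (fsig_poly fl n)`_n = 1.
Proof. by case: n => // n _; rewrite coef_poly ltnSn subnn gamma_top. Qed.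

Lemma fsig_poly_above fl n m : (n < m)%N -> (fsig_poly fl n)`_m = 0.
Proof. by move=> lt_nm; rewrite coef_poly ltnS leqNgt lt_nm. Qed.

(** Interpolation: the hypothesis for all powers [k] extends to polynomials in [iota (lc x)], in
    particular to one vanishing on [F] except at [e]. *)
Lemma sum_character (A : seq letter) (d : letter -> E) (e : F) :
  (forall k, \sum_(x <- A) d x * iota (lc x) ^+ k = 0) ->
  \sum_(x <- A | lc x == e) d x = 0.
Proof.
move=> d0; pose p : {poly E} := \prod_(c | c != e) ('X - (iota c)%:P).
have pE x : p.[iota (lc x)] = (lc x == e)%:R * p.[iota e].
  have [->|ne] := eqVneq (lc x) e; first by rewrite mul1r.
  by rewrite mul0r /p horner_prod (bigD1 (lc x)) //= hornerXsubC subrr mul0r.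
have pe : p.[iota e] != 0.
  rewrite /p horner_prod; apply/prodf_neq0 => c ce.
  by rewrite hornerXsubC subr_eq0 (inj_eq (fmorph_inj iota)) eq_sym.
have : \sum_(x <- A) d x * p.[iota (lc x)] = 0.
  under eq_bigr do rewrite horner_coef mulr_sumr.
  rewrite exchange_big big1 // => i _ /=.
  by under eq_bigr do rewrite mulrCA; rewrite -mulr_sumr d0 mulr0.
under eq_bigr do rewrite pE mulrA.
rewrite -mulr_suml => /eqP; rewrite mulf_eq0 (negPf pe) orbF => /eqP sum0; rewrite -[RHS]sum0.
rewrite big_mkcond; apply: eq_bigr => x _.
by case: ifP; rewrite ?mulr1 ?mulr0.
Qed.

(** Varying [k] isolates one character. Varying [t], the resulting polynomial in [1 / fexp] is zero
    by [fexp_generic]; letters of one character have distinct weights, hence give monic polynomials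
    of distinct degrees. *)
Lemma letters_separated g fl (A : seq letter) (d : letter -> E) : uniq A -> fvalid F (fl ++ g) ->
  (forall t k, fexp F (fl ++ g) t != 0 ->
     \sum_(x <- A) d x * (iota (lc x) ^+ k * fsig iota (fquot F g fl) (lw x) (fexp F g t)) = 0) ->
  {in A, forall x, d x = 0}.
Proof.
move=> A_uniq fl_ok d0 x; move: {2}(lc x) (erefl (lc x)) => e.
set h := fquot F g fl in d0 *.
have h_ok : fvalid F h by move: fl_ok; rewrite fvalid_cat => /andP[].
pose P : {poly E} := \sum_(x <- A | lc x == e) d x *: fsig_poly h (lw x).
have P0 : P = 0.
  apply/eqP; apply: contraT => /(fexp_generic (F := F) iota (fl ++ g) emb_inj)[t t0].
  rewrite /P horner_sum big_seq_cond => /negP[]; apply/eqP.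
  under eq_bigr => y _.
    rewrite hornerZ fexp_cat -horner_fsig_poly -?fexp_cat ?lw_gt0 //; over.
  rewrite -big_seq_cond; apply: sum_character => k; rewrite -[RHS](d0 t k t0).
  by apply: eq_bigr => y _; rewrite mulrAC mulrA.
pose B := \max_(y <- A) lw y.
(* Downward induction on the weight: at the coefficient of index [lw x], heavier letters already
   have [d = 0] and lighter ones have too small a degree. *)
have [n] := ubnP (B - lw x)%N; elim: n x => // n IHn x lt_n ex x_in.
have := congr1 (fun p : {poly E} => p`_(lw x)) P0.
rewrite /P coef_sum coef0 big_mkcond (bigD1_seq x) //= ex eqxx coefZ fsig_poly_top ?lw_gt0 // mulr1.
rewrite big_seq_cond big1 ?addr0 // => y /andP[y_in yx]; case: eqP => // ey.
rewrite coefZ; case: (ltngtP (lw x) (lw y)) => [lt_xy|lt_yx|eq_xy].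
- rewrite IHn ?mul0r //; apply: leq_trans (_ : B - lw x <= n)%N => //.
  by rewrite ltn_sub2l // (leq_trans lt_xy) // /B (big_rem y) //= leq_maxl.
- by rewrite fsig_poly_above ?mulr0.
- by case/eqP: yx; apply: letter_inj; rewrite ?ex.
Qed.

Fixpoint words_upto (A : seq letter) n : seq word :=
  if n is n'.+1 then [::] :: [seq x :: w | x <- A, w <- words_upto A n'] else [:: [::]].

Lemma words_upto_uniq A n : uniq A -> uniq (words_upto A n).
Proof.
move=> A_uniq; elim: n => //= n IHn; apply/andP; split.
  by apply/negP => /allpairsP[[x w] []].
by apply: allpairs_uniq => // -[x w] [x' w'] _ _ [-> ->].
Qed.

Lemma mem_words_upto A n w : all [in A] w -> (size w <= n)%N -> w \in words_upto A n.
Proof.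
elim: n w => [|n IHn] [|x w] //= /andP[x_in w_in] w_size.
by rewrite inE; apply/orP; right; apply: allpairs_f => //; exact: IHn.
Qed.

(** The relation at [(t, k) :: fl] minus the relation at [fl] keeps only the terms with first letter
    at [t]. Then [letters_separated] strips that letter, and the induction continues with the tails.
    The coefficient of the empty word is read off at the empty [fl]. *)
Lemma words_upto_separated g A n (c : word -> E) : uniq A ->
  (forall fl, fvalid F (fl ++ g) ->
     \sum_(w <- words_upto A n) c w * wev (fquot F g fl) w = 0) ->
  fvalid F g -> {in words_upto A n, forall w, c w = 0}.
Proof.
move=> A_uniq c0 g_ok; elim: n c c0 => [|n IHn] c c0 w.
  by rewrite inE => /eqP ->; have := c0 [::] g_ok; rewrite /= big_seq1 mulr1.
have cnil : c [::] = 0.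
  have := c0 [::] g_ok; rewrite /= big_cons mulr1 big_allpairs_dep big1 ?addr0 // => x _.
  by rewrite big1 // => v _; rewrite mulr0.
rewrite inE => /orP[/eqP ->//|/allpairsP[[x v] /= [x_in v_in ->]]].
pose d fl y := \sum_(u <- words_upto A n) c (y :: u) * wev (fquot F g fl) u.
apply: (IHn (fun u => c (x :: u))) v_in => fl fl_ok; rewrite -/(d fl x).
apply: (letters_separated (g := g) (fl := fl) (d := d fl) A_uniq) x_in => // t k t0.
have tfl_ok : fvalid F (((t, k) :: fl) ++ g) by apply/andP.
have := c0 _ tfl_ok; have := c0 _ fl_ok.
rewrite !big_cons cnil !mul0r !add0r !big_allpairs_dep => c1.
rewrite [fquot _ _ _]/=; set h := fquot F g fl.
under eq_bigr => y _ do under eq_bigr => u _ do rewrite wev_cons mulrDr.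
under eq_bigr => y _ do rewrite big_split.
rewrite big_split /= c1 add0r => c2; rewrite -[RHS]c2; apply: eq_bigr => y _.
by rewrite /d mulr_suml; apply: eq_bigr => u _; rewrite -/h; ring.
Qed.

Lemma words_separated g : fvalid F g ->
  separating (fun fl => fvalid F (fl ++ g)) (fun fl => wev (fquot F g fl)).
Proof.
move=> g_ok s c s_uniq c0.
pose A := undup (flatten s); pose n := \max_(w <- s) size w.
have sub_s : {subset s <= words_upto A n}.
  move=> w w_in; apply: mem_words_upto; last by rewrite /n (big_rem w) //= leq_maxl.
  by apply/allP => x x_in; rewrite /= mem_undup; apply/flattenP; exists w.
have A_uniq : uniq A := undup_uniq _.
pose c' w := if w \in s then c w else 0.
have c'0 := words_upto_separated (g := g) (n := n) (c := c') A_uniq.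
move=> w w_in; have : c' w = 0.
  apply: c'0 => //; last exact: sub_s.
  move=> fl fl_ok; rewrite -[RHS](c0 fl fl_ok).
  rewrite (big_subseq_ext _ s_uniq (words_upto_uniq n A_uniq)) //.
  by apply: eq_bigr => u _; rewrite /c'; case: ifP => _; rewrite ?mul0r.
by rewrite /c' w_in.
Qed.

End WordsSeparated.

(** * Antipode of a connected graded bialgebra *)

Section Antipode.
Variables (F : fieldType) (K : choiceType).
Local Notation D := {malg F[K]}.
Local Notation D2 := {malg F[(K * K)%type]}.
Variables (wt : K -> nat) (k0 : K) (mul : D -> D -> D) (cop : D -> D2) (eps : D -> F).
Hypothesis wt_k0 : forall k, wt k = 0%N -> k = k0.
Hypothesis mul_l : forall z, linear (mul ^~ z).
Hypothesis mul_r : forall z, linear (mul z).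
Hypothesis mulA : forall x y z, mul (mul x y) z = mul x (mul y z).
Hypothesis mul1x : forall x, mul << k0 >> x = x.
Hypothesis mulx1 : forall x, mul x << k0 >> = x.
Hypothesis cop_linear : linear cop.
Hypothesis eps_linear : forall c x y, eps (c *: x + y) = c * eps x + eps y.
Hypothesis coassoc : forall x, cop_id cop (cop x) = id_cop cop (cop x).
Hypothesis counit_l : forall x, eps_id eps (cop x) = x.
Hypothesis counit_r : forall x, id_eps eps (cop x) = x.
Hypothesis eps1 : eps << k0 >> = 1.
Hypothesis wt_cop : forall k p, p \in msupp (cop << k >>) -> (wt p.1 + wt p.2 = wt k)%N.
Hypothesis eps_wt : forall k, (0 < wt k)%N -> eps << k >> = 0.

Let eps_neq k : k != k0 -> eps << k >> = 0.
Proof. by move=> kk0; apply: eps_wt; rewrite lt0n; apply: contra_neq kk0 => /wt_k0. Qed.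

Let wt_neq k : k != k0 -> (0 < wt k)%N.
Proof. by rewrite lt0n; apply: contra_neq => /wt_k0. Qed.

Let mulZl c x y : mul (c *: x) y = c *: mul x y.
Proof.
have m0 : mul 0 y = 0 by have := mul_l y (-1) 0 0; rewrite scaler0 addr0 scaleN1r addNr.
by rewrite -[c *: x]addr0 [LHS]mul_l m0 addr0.
Qed.

Let mulZr c x y : mul x (c *: y) = c *: mul x y.
Proof.
have m0 : mul x 0 = 0 by have := mul_r x (-1) 0 0; rewrite scaler0 addr0 scaleN1r addNr.
by rewrite -[c *: y]addr0 [LHS]mul_r m0 addr0.
Qed.

(** The equation [S * id = u eps] solved for [S k]: the omitted terms with [p.2 = k0] make up [S k]
    itself, and the others have [wt p.1 < wt k], so fuel [(wt k).+1] suffices. *)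
Fixpoint antipode_l n k : D :=
  if n is n'.+1 then eps << k >> *: << k0 >> -
    lext (fun p => if p.2 == k0 then 0 else mul (antipode_l n' p.1) << p.2 >>) (cop << k >>)
  else 0.

Fixpoint antipode_r n k : D :=
  if n is n'.+1 then eps << k >> *: << k0 >> -
    lext (fun p => if p.1 == k0 then 0 else mul << p.1 >> (antipode_r n' p.2)) (cop << k >>)
  else 0.

Let SL : D -> D := lext (fun k => antipode_l (wt k).+1 k).
Let SR : D -> D := lext (fun k => antipode_r (wt k).+1 k).

Let SL_lext (I : choiceType) (f : I -> D) g : SL (lext f g) = lext (fun k => SL (f k)) g.
Proof. exact: (linear_lext _ _ (lext_linear _)). Qed.

Let SR_lext (I : choiceType) (f : I -> D) g : SR (lext f g) = lext (fun k => SR (f k)) g.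
Proof. exact: (linear_lext _ _ (lext_linear _)). Qed.

Let SLZ c x : SL (c *: x) = c *: SL x.
Proof. exact: linearZ. Qed.

Let SRZ c x : SR (c *: x) = c *: SR x.
Proof. exact: linearZ. Qed.

Let antipode_l_stable n m k : (wt k < n)%N -> (wt k < m)%N -> antipode_l n k = antipode_l m k.
Proof.
elim: n m k => [//|n IHn] [//|m] k lt_n lt_m; apply: (congr2 +%R erefl); congr (- _).
apply: eq_lext_in => p /wt_cop wt_p /=; case: eqP => // /eqP /wt_neq p2.
apply: (congr1 (mul ^~ _)); apply: IHn; apply: leq_trans (_ : wt k <= _)%N => //.
  by rewrite -wt_p -addn1 leq_add2l.
by rewrite -wt_p -addn1 leq_add2l.
Qed.

Let antipode_r_stable n m k : (wt k < n)%N -> (wt k < m)%N -> antipode_r n k = antipode_r m k.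
Proof.
elim: n m k => [//|n IHn] [//|m] k lt_n lt_m; apply: (congr2 +%R erefl); congr (- _).
apply: eq_lext_in => p /wt_cop wt_p /=; case: eqP => // /eqP /wt_neq p1.
apply: (congr1 (mul _)); apply: IHn; apply: leq_trans (_ : wt k <= _)%N => //.
  by rewrite -wt_p -add1n leq_add2r.
by rewrite -wt_p -add1n leq_add2r.
Qed.

(** The counit law writes [S k] as the sum of [eps(p.2) S(p.1)], and [eps] is 1 at [k0] and 0 at
    every other basis element. *)
Let mul_S_id_split (S : D -> D) k : linear S -> mul_S_id mul S (cop << k >>) =
  S << k >> + lext (fun p => if p.2 == k0 then 0 else mul (S << p.1 >>) << p.2 >>) (cop << k >>).
Proof.
move=> S_lin; have := counit_r << k >>; rewrite /id_eps => eq_k.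
rewrite -[in S _]eq_k (linear_lext _ _ S_lin) -[X in X + _]scale1r -lextP.
apply: eq_lext => p; rewrite scale1r.
have -> : S (eps << p.2 >> *: << p.1 >>) = eps << p.2 >> *: S << p.1 >>.
  have S0 : S 0 = 0 by have := S_lin (-1) 0 0; rewrite scaler0 addr0 scaleN1r addNr.
  by rewrite -[_ *: _]addr0 S_lin S0 addr0.
have [->|/eps_neq ->] := eqVneq p.2 k0; first by rewrite eps1 scale1r mulx1 addr0.
by rewrite scale0r add0r.
Qed.

Let mul_id_S_split (S : D -> D) k : linear S -> mul_id_S mul S (cop << k >>) =
  S << k >> + lext (fun p => if p.1 == k0 then 0 else mul << p.1 >> (S << p.2 >>)) (cop << k >>).
Proof.
move=> S_lin; have := counit_l << k >>; rewrite /eps_id => eq_k.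
rewrite -[in S _]eq_k (linear_lext _ _ S_lin) -[X in X + _]scale1r -lextP.
apply: eq_lext => p; rewrite scale1r.
have -> : S (eps << p.1 >> *: << p.2 >>) = eps << p.1 >> *: S << p.2 >>.
  have S0 : S 0 = 0 by have := S_lin (-1) 0 0; rewrite scaler0 addr0 scaleN1r addNr.
  by rewrite -[_ *: _]addr0 S_lin S0 addr0.
have [->|/eps_neq ->] := eqVneq p.1 k0; first by rewrite eps1 scale1r mul1x addr0.
by rewrite scale0r add0r.
Qed.

Let SL_basis k : mul_S_id mul SL (cop << k >>) = eps << k >> *: << k0 >>.
Proof.
rewrite mul_S_id_split; last exact: lext_linear.
rewrite {1}/SL lextU.
rewrite [X in _ + X](@eq_lext_in _ _ _ _
  (fun p => if p.2 == k0 then 0 else mul (antipode_l (wt k) p.1) << p.2 >>)).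
  exact: subrK.
move=> p /wt_cop wt_p; case: eqP => // /eqP/wt_neq p2; apply: (congr1 (mul ^~ _)); rewrite /SL lextU.
by apply: antipode_l_stable; rewrite // -wt_p -addn1 leq_add2l.
Qed.

Let SR_basis k : mul_id_S mul SR (cop << k >>) = eps << k >> *: << k0 >>.
Proof.
rewrite mul_id_S_split; last exact: lext_linear.
rewrite {1}/SR lextU.
rewrite [X in _ + X](@eq_lext_in _ _ _ _
  (fun p => if p.1 == k0 then 0 else mul << p.1 >> (antipode_r (wt k) p.2))).
  exact: subrK.
move=> p /wt_cop wt_p; case: eqP => // /eqP/wt_neq p1; apply: (congr1 (mul _)); rewrite /SR lextU.
by apply: antipode_r_stable; rewrite // -wt_p -add1n leq_add2r.
Qed.

Let lext_cop (V : lmodType F) (f : K * K -> V) : linear (fun x => lext f (cop x)).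
Proof. by move=> c x y; rewrite cop_linear lext_linear. Qed.

Let unit_eps : linear (fun x => eps x *: << k0 >> : D).
Proof. by move=> c x y; rewrite eps_linear scalerDl scalerA. Qed.

Let SL_left x : mul_S_id mul SL (cop x) = eps x *: << k0 >>.
Proof. exact: (linear_ext (lext_cop _) unit_eps SL_basis). Qed.

Let SR_right x : mul_id_S mul SR (cop x) = eps x *: << k0 >>.
Proof. exact: (linear_ext (lext_cop _) unit_eps SR_basis). Qed.

(* [SL * (id * SR) = (SL * id) * SR] in the convolution algebra. *)
Let SL_SR x : SL x = SR x.
Proof.
pose T (r : K * K * K) := mul (mul (SL << r.1.1 >>) << r.1.2 >>) (SR << r.2 >>).
have -> : SR x = lext T (cop_id cop (cop x)).
  rewrite -[in LHS](counit_l x) /eps_id SR_lext.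
  rewrite /cop_id (linear_lext _ _ (lext_linear _)); apply: eq_lext => p.
  rewrite SRZ -[SR _ in LHS]mul1x -mulZl -SL_left /mul_S_id.
  rewrite (linear_lext _ _ (mul_l _)) (linear_lext _ _ (lext_linear _)).
  by apply: eq_lext => r; rewrite lextU.
rewrite coassoc -[in LHS](counit_r x) /id_eps SL_lext.
rewrite /id_cop (linear_lext _ _ (lext_linear _)); apply: eq_lext => p.
rewrite SLZ -[SL _ in LHS]mulx1 -mulZr -SR_right /mul_id_S.
rewrite (linear_lext _ _ (mul_r _)) (linear_lext _ _ (lext_linear _)).
by apply: eq_lext => r; rewrite lextU /T mulA.
Qed.

Lemma connected_graded_antipode : exists S : D -> D, linear S /\
  forall x, mul_S_id mul S (cop x) = eps x *: << k0 >> /\ mul_id_S mul S (cop x) = eps x *: << k0 >>.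
Proof.
exists SL; split; first exact: lext_linear.
move=> x; split; first exact: SL_left.
by rewrite -SR_right; apply: eq_lext => p; rewrite SL_SR.
Qed.

End Antipode.

(** * The Hopf algebra axioms *)

Section HopfAlgebra.
Variable F : finFieldType.
Local Notation letter := (letter F).
Local Notation word := (word F).
Local Notation D := {malg F[word]}.
Local Notation shuffle := (@shuffle F).
Local Notation coproduct := (@coproduct F).
Local Notation counit := (@counit F).
Implicit Types (u v w : word) (X Y Z : D).

Lemma shuffle_linear_l Z : linear (shuffle ^~ Z).
Proof. exact: lext_linear. Qed.

Lemma shuffle_linear_r Z : linear (shuffle Z).
Proof.
move=> c X Y; rewrite /Defs.shuffle /bilext -lextP; apply: eq_lext => w.
exact: lext_linear.
Qed.

Lemma shuffle1l X : shuffle << [::] >> X = X.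
Proof. by rewrite /Defs.shuffle /bilext lextU -[RHS]lext_basis. Qed.

Definition weighted n : pred word := fun w => weight w == n.

Lemma shuffle_weighted n m X Y : supported (weighted n) X -> supported (weighted m) Y ->
  supported (weighted (n + m)%N) (shuffle X Y).
Proof.
move=> X_n Y_m; apply: supported_lext => v /X_n /eqP <-.
by apply: supported_lext => w /Y_m /eqP <- u /sh_fuel_supported /andP[].
Qed.

Lemma brk_weighted n c : c \in compositions n -> supported (weighted n) (brk F c).
Proof.
move=> c_in; apply: supportedZ; rewrite -(compositions_sum c_in).
have := compositions_gt0 c_in; elim: c {c_in} => [|i c IHc] c_gt0.
  exact: supportedU.
apply: shuffle_weighted; last by apply: IHc => j j_in; apply: c_gt0; rewrite inE j_in orbT.
apply: supportedU; rewrite /weighted weight_cons weight_nil addn0 lw_L ?oner_neq0 //.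
by apply: c_gt0; rewrite inE eqxx.
Qed.

Lemma cop_word_weighted w :
  supported (fun p => weight p.1 + weight p.2 == weight w)%N (cop_word w).
Proof.
elim: w => [|x v IHv]; first exact: supportedU.
rewrite cop_word_cons; apply: supportedD; first exact: supportedU.
apply: supported_sum => r; rewrite mem_iota add1n ltnS => /andP[r0 le_r].
apply: supported_sum => c c_in; apply: supportedZ; apply: supported_lext => p /IHv /eqP p_wt.
have p2 : supported (weighted (weight p.2)) (<< p.2 >> : D) by apply: supportedU; exact: eqxx.
apply: supported_lext => w /(shuffle_weighted (brk_weighted c_in) p2) /eqP w_wt.
apply: supportedU; rewrite !weight_cons w_wt lw_L ?lc_neq0 //= -p_wt.
by rewrite -addnA [(weight p.1 + _)%N]addnCA !addnA subnKC.
Qed.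

Local Notation E := {fraction {poly F}}.
Local Notation iota := (@tofrac {poly F} \o polyC : {rmorphism F -> E}).

(** Witnesses that [E] is infinite, as required by [fexp_generic]. *)
Definition emb (n : nat) : E := tofrac 'X^n.

Lemma emb_inj : injective emb.
Proof.
move=> n m /eqP; rewrite /emb tofrac_eq => /eqP /(congr1 (fun p : {poly F} => size p)).
by rewrite !size_polyXn => -[].
Qed.

Local Notation ev fl := (vext iota (wev iota fl)).

Lemma fquot0 (fl : seq (E * nat)) : fquot F [::] fl = fl.
Proof. by rewrite /fquot -[RHS]map_id; apply: eq_map => -[]. Qed.

Lemma words_separated0 : separating (fun fl => fvalid F fl) (fun fl => wev iota fl).
Proof.
move=> s c s_uniq c0; apply: (words_separated emb_inj (g := [::]) _ s_uniq) => // fl.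
by rewrite cats0 fquot0; exact: c0.
Qed.

Lemma ev_inj X Y : (forall fl, fvalid F fl -> ev fl X = ev fl Y) -> X = Y.
Proof. exact: separating_vext words_separated0. Qed.

Lemma ev2_inj (X Y : {malg F[(word * word)%type]}) :
  (forall fl fl', fvalid F (fl' ++ fl) ->
     vext iota (wev2 iota (fquot F fl fl') fl) X = vext iota (wev2 iota (fquot F fl fl') fl) Y) ->
  X = Y.
Proof.
move=> eqXY; apply: (separating_vext (separating_prod (words_separated emb_inj) words_separated0)).
by move=> [fl fl'] /= [_ fl_ok]; exact: eqXY.
Qed.

Definition wev3 fl'' fl' fl (p : word * word * word) : E :=
  wev iota fl'' p.1.1 * wev iota fl' p.1.2 * wev iota fl p.2.

(** [separating_prod] is applied twice: to the first two tensor factors relative to a fixed [fl],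
    then with [fl] varying for the third. *)
Lemma ev3_inj (X Y : {malg F[(word * word * word)%type]}) :
  (forall fl fl' fl'', fvalid F (fl'' ++ fl' ++ fl) ->
     vext iota (wev3 (fquot F (fl' ++ fl) fl'') (fquot F fl fl') fl) X =
     vext iota (wev3 (fquot F (fl' ++ fl) fl'') (fquot F fl fl') fl) Y) ->
  X = Y.
Proof.
move=> eqXY.
have sep2 fl : fvalid F fl -> separating
    (fun ij : seq (E * nat) * seq (E * nat) => fvalid F (ij.1 ++ fl) /\ fvalid F (ij.2 ++ ij.1 ++ fl))
    (fun ij (k : word * word) =>
       wev iota (fquot F (ij.1 ++ fl) ij.2) k.1 * wev iota (fquot F fl ij.1) k.2).
  move=> fl_ok; apply: (@separating_prod E _ _ _ _ (fun j => fvalid F (j ++ fl))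
    (fun j i => fvalid F (i ++ j ++ fl)) (fun j i => wev iota (fquot F (j ++ fl) i))
    (fun j => wev iota (fquot F fl j))) => [j j_ok|]; exact: words_separated emb_inj _ _.
apply: (separating_vext (separating_prod sep2 words_separated0)).
by move=> [fl [fl' fl'']] /= [_ [_ fl_ok]]; exact: eqXY.
Qed.

(** The counit is evaluation at the empty flag, so the counit laws come from the decompositions
    [[::] ++ fl] and [fl ++ [::]]. *)
Lemma iota_counit X : iota (counit X) = ev [::] X.
Proof. by rewrite vext_wev_flag0. Qed.

Lemma fvalid_quot fl' fl : fvalid F (fl' ++ fl) -> @fvalid F E (fquot F fl fl').
Proof. by rewrite fvalid_cat => /andP[]. Qed.

Lemma fvalid_catr fl' fl : fvalid F (fl' ++ fl) -> @fvalid F E fl.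
Proof. by rewrite fvalid_cat => /andP[]. Qed.

Lemma shuffleA X Y Z : shuffle (shuffle X Y) Z = shuffle X (shuffle Y Z).
Proof.
apply: ev_inj => fl fl_ok; have evM U V := shuffle_wev iota U V fl_ok.
by rewrite [LHS]evM [RHS]evM [in LHS]evM [in RHS]evM mulrA.
Qed.

Lemma coproduct_coassoc X :
  cop_id coproduct (coproduct X) = id_cop coproduct (coproduct X).
Proof.
apply: ev3_inj => fl fl' fl'' fl_ok.
have fl_ok' := fl_ok; rewrite catA in fl_ok'.
(* The two iterated coproducts correspond to the two bracketings of the triple concatenation; on the
   left, [fquot_cat] identifies the iterated quotient flags. *)
transitivity (ev (fl'' ++ fl' ++ fl) X).
  rewrite catA -(coproduct_wev2 _ _ fl_ok') [LHS]vext_lext; apply: eq_vext => p.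
  have fquotD : fquot F fl (fl'' ++ fl') = fquot F fl fl'' ++ fquot F fl fl' by rewrite /fquot map_cat.
  have := fvalid_quot fl_ok'; rewrite [LHS]vext_lext /wev2 fquotD => pq_ok.
  rewrite -[wev iota _ p.1](vextU iota) -(coproduct_wev2 _ _ pq_ok) -vext_mulr.
  by apply: eq_vext => r; rewrite vextU /wev3 fquot_cat.
rewrite -(coproduct_wev2 _ _ fl_ok) [RHS]vext_lext; apply: eq_vext => p.
rewrite [RHS]vext_lext /wev2 -[wev iota _ p.2](vextU iota).
rewrite -(coproduct_wev2 _ _ (fvalid_catr fl_ok)) -vext_mull.
by apply: eq_vext => r; rewrite vextU /wev3 /wev2 mulrA.
Qed.

Lemma coproduct_counit_l X : eps_id counit (coproduct X) = X.
Proof.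
apply: ev_inj => fl fl_ok; rewrite -[in RHS](cat0s fl) -coproduct_wev2 // vext_lext.
by apply: eq_vext => p; rewrite vextZ iota_counit !vextU.
Qed.

Lemma coproduct_counit_r X : id_eps counit (coproduct X) = X.
Proof.
apply: ev_inj => fl; rewrite -[fl in fvalid _ fl]cats0 => fl_ok.
rewrite -[in RHS](cats0 fl) -coproduct_wev2 // vext_lext fquot0.
by apply: eq_vext => p; rewrite vextZ iota_counit !vextU mulrC.
Qed.

Lemma vext_tens (phi psi : word -> E) X Y :
  vext iota (fun p => phi p.1 * psi p.2) (tens X Y) = vext iota phi X * vext iota psi Y.
Proof.
rewrite vext_lext -vext_mulr; apply: eq_vext => v.
by rewrite vext_lext -vext_mull; apply: eq_vext => w; rewrite vextU.
Qed.

(** Evaluation at [(e(fl'), fl)] is multiplicative on D ⊗ D, and its composite with Δ, evaluation at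
    [fl' ++ fl], is multiplicative on D. *)
Lemma coproduct_shuffle X Y : coproduct (shuffle X Y) = mul2 shuffle (coproduct X) (coproduct Y).
Proof.
apply: ev2_inj => fl fl' fl_ok.
have copE U := coproduct_wev2 iota U fl_ok.
have evM U V := shuffle_wev iota U V (fvalid_catr fl_ok).
have evM' U V := shuffle_wev iota U V (fvalid_quot fl_ok).
rewrite [LHS]copE (shuffle_wev _ _ _ fl_ok) -[in X in X * _]copE -[in X in _ * X]copE.
rewrite [RHS]vext_lext -vext_mulr; apply: eq_vext => p.
rewrite [RHS]vext_lext -vext_mull; apply: eq_vext => p'.
by rewrite [RHS]vext_tens [in RHS]evM' [in RHS]evM !vextU mulrACA.
Qed.

Lemma counit_shuffle X Y : counit (shuffle X Y) = counit X * counit Y.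
Proof.
apply: (fmorph_inj iota).
by rewrite rmorphM !iota_counit shuffle_wev.
Qed.

Lemma weight_eq0 w : weight w = 0%N -> w = [::].
Proof. by case: w => // x w; rewrite weight_cons => /eqP; rewrite addn_eq0 eqn0Ngt lw_gt0. Qed.

Lemma leq_size_weight w : (size w <= weight w)%N.
Proof.
elim: w => // x w IHw; rewrite weight_cons /= -add1n.
exact: leq_add (lw_gt0 x) IHw.
Qed.

Lemma words_of_weight n : exists s : seq word, forall w, weight w = n -> w \in s.
Proof.
(* Letters of weight at most [n]; the entries with [e = 0] contribute the default letter. *)
pose A := undup [seq @L F i e | i <- seq.iota 1 n, e <- enum F].
exists (words_upto A n) => w w_n; apply: mem_words_upto; last by rewrite -w_n leq_size_weight.
have : (weight w <= n)%N by rewrite w_n.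
elim: w {w_n} => // x w IHw; rewrite weight_cons => le_n /=.
rewrite IHw ?(leq_trans (leq_addl _ _) le_n) // andbT mem_undup.
apply/allpairsP; exists (lw x, lc x); split => /=.
- by rewrite mem_iota lw_gt0 add1n ltnS (leq_trans (leq_addr _ _) le_n).
- by rewrite mem_enum.
- by apply: letter_inj; rewrite ?lw_L ?lc_L ?lw_gt0 ?lc_neq0.
Qed.

Lemma connected_weight X : homog (@weight F) 0 X -> exists c : F, X = c *: oneD F.
Proof.
move=> X0; exists X@_[::]; apply/malgP => w.
rewrite mcoeffZ mcoeffU; have [<-|w0] := eqVneq [::] w; first by rewrite mulr1.
rewrite mulr0; apply/eqP; rewrite mcoeff_eq0; apply: contraNN w0 => /X0/weight_eq0 ->.
exact: eqxx.
Qed.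

End HopfAlgebra.

(* (D, ⧢, u, Δ, ε) is a connected graded Hopf algebra of finite type over F_q,
   for every finite field F = F_q. *)
Theorem theorem6p9 (F : finFieldType) :
  is_conn_graded_Hopf_finite_type (@weight F) (@shuffle F) (@oneD F)
    (@coproduct F) (@counit F).
Proof.
have eps_lin (c : F) x y : counit (c *: x + y) = c * counit x + counit y.
  by rewrite /counit mcoeffD mcoeffZ.
have eps_wt w : (0 < weight w)%N -> counit (<< w >> : {malg F[word F]}) = 0.
  by rewrite /counit mcoeffU; case: eqP => // ->.
have wt_cop (w : word F) p : p \in msupp (coproduct << w >>) -> (weight p.1 + weight p.2 = weight w)%N.
  by rewrite /coproduct lextU => /cop_word_weighted/eqP.
split.
- by move=> c x y z; exact: shuffle_linear_l.
- by move=> c x y z; exact: shuffle_linear_r.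
- exact: lext_linear.
- exact: eps_lin.
- exact: shuffleA.
- exact: shuffle1l.
- exact: shuffle1r.
- exact: coproduct_coassoc.
- exact: coproduct_counit_l.
- exact: coproduct_counit_r.
- exact: coproduct_shuffle.
- by rewrite /coproduct /oneD /tens /bilext !lextU.
- exact: counit_shuffle.
- exact: mcoeffUU.
- apply: (connected_graded_antipode (wt := @weight F) (k0 := [::])).
  + exact: weight_eq0.
  + exact: shuffle_linear_l.
  + exact: shuffle_linear_r.
  + exact: shuffleA.
  + exact: shuffle1l.
  + exact: shuffle1r.
  + exact: lext_linear.
  + exact: eps_lin.
  + exact: coproduct_coassoc.
  + exact: coproduct_counit_l.
  + exact: coproduct_counit_r.
  + exact: mcoeffUU.
  + exact: wt_cop.
  + exact: eps_wt.
- by move=> w; rewrite msuppU oner_eq0 in_fset1 => /eqP ->.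
- by move=> v w u; rewrite /shuffle /bilext !lextU => /sh_fuel_supported /andP[_ /eqP].
- exact: wt_cop.
- exact: eps_wt.
- exact: connected_weight.
- exact: words_of_weight.
Qed.
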